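(* Let $n\ge 4$ be an integer and let $c\in\mathbb{C}$. Every finite-dimensional irreducible representation of the rational Cherednik algebra $H_c(D_n,\mathbb{C}^n)$ is isomorphic to the restriction to $H_c(D_n,\mathbb{C}^n)$, along the natural embedding $H_c(D_n,\mathbb{C}^n)\subset H_{c,0}(B_n,\mathbb{C}^n)$, of a finite-dimensional irreducible representation of the rational Cherednik algebra $H_{c,0}(B_n,\mathbb{C}^n)$.
   Context: Rational Cherednik algebra: let $W$ be a finite complex reflection group with reflection representation $\mathfrak{h}$, $S\subset W$ its set of reflections, and $c:S\to\mathbb{C}$ a $W$-invariant function. For $s\in S$ let $\alpha_s\in\mathfrak{h}^*$ be an eigenvector of $s$ with eigenvalue $\lambda_s\ne 1$ and $\alpha_s^\vee\in\mathfrak{h}$ an eigenvector of $s$ with eigenvalue $\lambda_s^{-1}$, normalized so that $\langle\alpha_s,\alpha_s^\vee\rangle=2$. Then $H_c(W,\mathfrak{h})$ is the quotient of $\mathbb{C}W\ltimes T(\mathfrak{h}^*\oplus\mathfrak{h})$ by the relations $[x,x']=[y,y']=0$ and $[y,x]=\langle y,x\rangle-\sum_{s\in S}c_s\langle\alpha_s,y\rangle\langle x,\alpha_s^\vee\rangle s$ for all $x,x'\in\mathfrak{h}^*$, $y,y'\in\mathfrak{h}$. Types $B$ and $D$: $B_n=S_n\ltimes(\mathbb{Z}/2\mathbb{Z})^n$ acts on $\mathbb{C}^n$ by permutations and sign changes of the coordinates, and $D_n\subset B_n$ is the index $2$ subgroup of elements with an even number of sign changes. A parameter for $D_n$ is a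 complex number $c$, the value on the reflections in the hyperplanes $z_i=\pm z_j$. A parameter for $B_n$ is a pair $(c_1,c_2)\in\mathbb{C}^2$, where $c_1$ is the value on the reflections in the hyperplanes $z_i=\pm z_j$ and $c_2$ is the value on the reflections in the hyperplanes $z_i=0$. The inclusions of $D_n\subset B_n$, $\mathfrak{h}=\mathbb{C}^n$ and $\mathfrak{h}^*$ induce an embedding of algebras $H_c(D_n,\mathbb{C}^n)\hookrightarrow H_{c,0}(B_n,\mathbb{C}^n)$. *)

(* Defs.v *)
From HB Require Import structures.
From mathcomp Require Import all_boot all_order all_algebra all_fingroup.
From mathcomp Require Import all_character.
From mathcomp Require Import boolp classical_sets reals.
From mathcomp Require Import finmap complex monalg ring.

Set Implicit Arguments.
Unset Strict Implicit.
Unset Printing Implicit Defensive.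

Import GRing.Theory.
Local Open Scope ring_scope.

(* An algebra over a field is a ring with a ring morphism from the field to its
   centre.  The library's algType excludes the zero ring, and a presented algebra
   is not known a priori to be nonzero. *)
HB.mixin Record PzRing_isAssocAlg (F : fieldType) A of GRing.PzRing A := {
  scal : F -> A;
  scalD : {morph scal : a b / a + b};
  scalM : {morph scal : a b / a * b};
  scal1 : scal 1 = 1;
  scal_central : forall (a : F) (x : A), scal a * x = x * scal a
}.

#[short(type="assocAlgType")]
HB.structure Definition AssocAlg (F : fieldType) :=
  {A of GRing.PzRing A & PzRing_isAssocAlg F A}.

Record algHom (F : fieldType) (A B : assocAlgType F) := AlgHom {
  alg_hom :> A -> B;
  alg_homD : {morph alg_hom : x y / x + y};
  alg_homM : {morph alg_hom : x y / x * y};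
  alg_hom_scal : forall a : F, alg_hom (scal a) = scal a
}.

Section AlgHomTheory.
Variables (F : fieldType) (A B : assocAlgType F) (f : algHom A B).

Lemma alg_hom0 : f 0 = 0.
Proof. by apply: (addrI (f 0)); rewrite -alg_homD !addr0. Qed.

Lemma alg_hom1 : f 1 = 1.
Proof. by rewrite -(scal1 (F := F)) alg_hom_scal scal1. Qed.

Lemma alg_homN x : f (- x) = - f x.
Proof. by apply: (addrI (f x)); rewrite -alg_homD !subrr alg_hom0. Qed.

Lemma alg_homB x y : f (x - y) = f x - f y.
Proof. by rewrite alg_homD alg_homN. Qed.

Lemma alg_hom_sum I (r : seq I) (P : pred I) (E : I -> A) :
  f (\sum_(i <- r | P i) E i) = \sum_(i <- r | P i) f (E i).
Proof. exact: (big_morph _ (alg_homD f) alg_hom0). Qed.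

Lemma alg_hom_eqMM x y z t : x * y = z * t -> f x * f y = f z * f t.
Proof. by move=> /(congr1 f); rewrite !alg_homM. Qed.

Lemma alg_hom_eqM x y z : x = y * z -> f x = f y * f z.
Proof. by move=> ->; rewrite alg_homM. Qed.

Lemma alg_hom_eq_lin (a : F) x y z :
  x = scal a * y + z -> f x = scal a * f y + f z.
Proof. by move=> ->; rewrite alg_homD alg_homM alg_hom_scal. Qed.

End AlgHomTheory.

(* Free associative algebra on a type of letters: the monoid algebra of the
   free monoid of words. *)
Definition word (T : choiceType) := seq T.
HB.instance Definition _ (T : choiceType) := Choice.on (word T).

Lemma cat_unit (T : choiceType) (x y : word T) :
  x ++ y = [::] -> x = [::] /\ y = [::].
Proof. by case: x => //; case: y. Qed.

HB.instance Definition _ (T : choiceType) :=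
  @Choice_isMonomialDef.Build (word T) [::] cat (@catA T) (@cat0s T) (@cats0 T)
    (@cat_unit T).

Definition free_alg (F : fieldType) (T : choiceType) : Type := {malg F[word T]}.
HB.instance Definition _ (F : fieldType) (T : choiceType) :=
  GRing.Lalgebra.on (free_alg F T).

Section FreeAlg.
Variables (F : fieldType) (T : choiceType).

Lemma free_scal_central (a : F) (x : free_alg F T) :
  a%:MP * x = x * a%:MP :> free_alg F T.
Proof.
rewrite !malgM_def fgmulUg fgmulgU; apply: eq_bigr => k _.
by rewrite mul1m mulm1 mulrC.
Qed.

HB.instance Definition _ := PzRing_isAssocAlg.Build F (free_alg F T)
  (@monalgUD (word T) F [::]) (@mpolyCM (word T) F) (@mpolyC1E (word T) F)
  free_scal_central.

End FreeAlg.

HB.lock Definition letter (F : fieldType) (T : choiceType) (t : T) :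
  free_alg F T := << ([:: t] : word T) >>.

Section FreeLift.
Variables (F : fieldType) (T : choiceType).
Variables (A : assocAlgType F) (f : T -> A).

Definition word_eval (k : word T) : A := \prod_(t <- k) f t.

Definition free_eval (p : free_alg F T) : A :=
  \sum_(k <- msupp p) scal p@_k * word_eval k.

Lemma assoc_scal0 : scal 0 = 0 :> A.
Proof. by apply: (addrI (scal 0)); rewrite -scalD !addr0. Qed.

Lemma free_evalw (d : {fset word T}) (p : free_alg F T) :
  (msupp p `<=` d)%fset -> free_eval p = \sum_(k <- d) scal p@_k * word_eval k.
Proof.
move=> le; rewrite /free_eval (big_fset_incl _ le) // => k _ /mcoeff_outdom ->.
by rewrite assoc_scal0 mul0r.
Qed.

Lemma free_evalD : {morph free_eval : p q / p + q}.
Proof.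
move=> p q; rewrite (free_evalw (msuppD_le p q)).
rewrite (@free_evalw (msupp p `|` msupp q)%fset p) ?fsubsetUl //.
rewrite (@free_evalw (msupp p `|` msupp q)%fset q) ?fsubsetUr //.
rewrite -big_split; apply: eq_bigr => w _ /=.
by rewrite mcoeffD scalD mulrDl.
Qed.

Lemma free_eval0 : free_eval 0 = 0.
Proof. by rewrite /free_eval msupp0 big_seq_fset0. Qed.

Lemma free_evalU (a : F) (k : word T) :
  free_eval << a *g k >> = scal a * word_eval k.
Proof. by rewrite (free_evalw msuppU_le) big_seq_fset1 mcoeffUU. Qed.

Lemma free_eval_sum I (r : seq I) (E : I -> free_alg F T) :
  free_eval (\sum_(i <- r) E i) = \sum_(i <- r) free_eval (E i).
Proof. exact: (big_morph _ free_evalD free_eval0). Qed.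

Lemma free_evalM : {morph free_eval : p q / p * q}.
Proof.
move=> p q; rewrite malgME free_eval_sum mulr_suml; apply: eq_bigr => k _.
rewrite free_eval_sum mulr_sumr; apply: eq_bigr => l _.
rewrite free_evalU scalM /word_eval big_cat /=.
by rewrite -!mulrA; congr (_ * _); rewrite !mulrA scal_central.
Qed.

Lemma free_eval_scal (a : F) : free_eval (scal a) = scal a.
Proof. by rewrite /scal/= free_evalU /word_eval big_nil mulr1. Qed.

Definition free_lift : algHom (free_alg F T) A :=
  AlgHom free_evalD free_evalM free_eval_scal.

Lemma free_lift_letter t : free_lift (letter F t) = f t.
Proof. by rewrite letter.unlock /= free_evalU scal1 mul1r /word_eval big_seq1. Qed.

End FreeLift.

Section AlgQuotient.
Variables (F : fieldType) (A : assocAlgType F).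

Definition two_sided_ideal (J : set A) :=
  [/\ J 0, (forall x y, J x -> J y -> J (x + y)) &
      forall a x b, J x -> J (a * x * b)].

Definition ideal_gen (rel : set A) : set A :=
  [set x | forall J, two_sided_ideal J -> (forall y, rel y -> J y) -> J x].

Variable rel : set A.

Lemma ideal_gen_ideal : two_sided_ideal (ideal_gen rel).
Proof.
split=> [J [] //|x y Hx Hy J HJ HR|a x b Hx J HJ HR].
  by case: (HJ) => _ H _; apply: H; [apply: Hx|apply: Hy].
by case: (HJ) => _ _; apply; apply: Hx.
Qed.

Lemma ideal_gen_rel x : rel x -> ideal_gen rel x.
Proof. by move=> H J _; apply. Qed.

Let I := ideal_gen rel.

Lemma ideal_gen0 : I 0. Proof. by case: ideal_gen_ideal. Qed.
Lemma ideal_genD x y : I x -> I y -> I (x + y).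
Proof. by case: ideal_gen_ideal => _ H _; apply: H. Qed.
Lemma ideal_genMl a x : I x -> I (a * x).
Proof. by case: ideal_gen_ideal => _ _ H /(H a _ 1); rewrite mulr1. Qed.
Lemma ideal_genMr b x : I x -> I (x * b).
Proof. by case: ideal_gen_ideal => _ _ H /(H 1 _ b); rewrite mul1r. Qed.
Lemma ideal_genN x : I x -> I (- x).
Proof. by rewrite -mulN1r; apply: ideal_genMl. Qed.

Definition ideal_cong (x y : A) : bool := `[< I (x - y) >].

Lemma ideal_congP : equiv_class_of ideal_cong.
Proof.
apply: EquivClass => [x|x y|y x z].
- by apply/asboolP; rewrite subrr; apply: ideal_gen0.
- by apply/asboolP/asboolP => /ideal_genN; rewrite opprB.
- move=> /asboolP H1 /asboolP H2; apply/asboolP.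
  by have := ideal_genD H1 H2; rewrite addrA subrK.
Qed.

Canonical ideal_cong_equiv := EquivRelPack ideal_congP.

Definition alg_quot := {eq_quot ideal_cong}%qT.
HB.instance Definition _ := Choice.on alg_quot.

Definition quot_proj (x : A) : alg_quot := \pi_(alg_quot)%qT x.

Lemma quot_projP x y : quot_proj x = quot_proj y <-> I (x - y).
Proof.
split=> [/eqP|H]; first by rewrite eqmodE => /asboolP.
by apply/eqP; rewrite eqmodE; apply/asboolP.
Qed.

Definition quot_repr (q : alg_quot) : A := generic_quotient.repr q.

Lemma quot_projK (q : alg_quot) : quot_proj (quot_repr q) = q.
Proof. exact: reprK. Qed.

Lemma repr_proj x : I (quot_repr (quot_proj x) - x).
Proof. by apply/quot_projP; rewrite quot_projK. Qed.

Let Q := alg_quot.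
Definition quot_add (p q : Q) : Q := quot_proj (quot_repr p + quot_repr q).
Definition quot_opp (p : Q) : Q := quot_proj (- quot_repr p).
Definition quot_mul (p q : Q) : Q := quot_proj (quot_repr p * quot_repr q).

Lemma quot_addE x y : quot_add (quot_proj x) (quot_proj y) = quot_proj (x + y).
Proof.
apply/quot_projP; rewrite opprD addrACA.
by apply: ideal_genD; apply: repr_proj.
Qed.

Lemma quot_oppE x : quot_opp (quot_proj x) = quot_proj (- x).
Proof.
by apply/quot_projP; rewrite -opprD; apply: ideal_genN; apply: repr_proj.
Qed.

Lemma quot_mulE x y : quot_mul (quot_proj x) (quot_proj y) = quot_proj (x * y).
Proof.
apply/quot_projP; set x' := quot_repr _; set y' := quot_repr _.
have -> : x' * y' - x * y = (x' - x) * y' + x * (y' - y).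
  by rewrite mulrBl mulrBr addrA subrK.
apply: ideal_genD; first by apply: ideal_genMr; apply: repr_proj.
by apply: ideal_genMl; apply: repr_proj.
Qed.

Lemma quot_ind (P : Q -> Prop) : (forall x, P (quot_proj x)) -> forall q, P q.
Proof. by move=> H q; rewrite -(quot_projK q). Qed.

Lemma quot_addA : associative quot_add.
Proof.
elim/quot_ind=> x; elim/quot_ind=> y; elim/quot_ind=> z.
by rewrite !quot_addE addrA.
Qed.
Lemma quot_addC : commutative quot_add.
Proof. by elim/quot_ind=> x; elim/quot_ind=> y; rewrite !quot_addE addrC. Qed.
Lemma quot_add0 : left_id (quot_proj 0) quot_add.
Proof. by elim/quot_ind=> x; rewrite quot_addE add0r. Qed.
Lemma quot_addN : left_inverse (quot_proj 0) quot_opp quot_add.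
Proof. by elim/quot_ind=> x; rewrite quot_oppE quot_addE addNr. Qed.
HB.instance Definition _ :=
  GRing.isZmodule.Build alg_quot quot_addA quot_addC quot_add0 quot_addN.

Lemma quot_projD x y : quot_proj (x + y) = quot_proj x + quot_proj y.
Proof. by rewrite -quot_addE. Qed.

Lemma quot_mulA : associative quot_mul.
Proof.
elim/quot_ind=> x; elim/quot_ind=> y; elim/quot_ind=> z.
by rewrite !quot_mulE mulrA.
Qed.
Lemma quot_mul1 : left_id (quot_proj 1) quot_mul.
Proof. by elim/quot_ind=> x; rewrite quot_mulE mul1r. Qed.
Lemma quot_1mul : right_id (quot_proj 1) quot_mul.
Proof. by elim/quot_ind=> x; rewrite quot_mulE mulr1. Qed.
Lemma quot_mulDl : left_distributive quot_mul +%R.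
Proof.
elim/quot_ind=> x; elim/quot_ind=> y; elim/quot_ind=> z.
by rewrite -quot_projD !quot_mulE mulrDl quot_projD.
Qed.
Lemma quot_mulDr : right_distributive quot_mul +%R.
Proof.
elim/quot_ind=> x; elim/quot_ind=> y; elim/quot_ind=> z.
by rewrite -quot_projD !quot_mulE mulrDr quot_projD.
Qed.
HB.instance Definition _ := GRing.Zmodule_isPzRing.Build alg_quot
  quot_mulA quot_mul1 quot_1mul quot_mulDl quot_mulDr.

Lemma quot_projM x y : quot_proj (x * y) = quot_proj x * quot_proj y.
Proof. by rewrite -quot_mulE. Qed.

Definition quot_scal (a : F) : Q := quot_proj (scal a).

Lemma quot_scalD : {morph quot_scal : a b / a + b}.
Proof. by move=> a b; rewrite /quot_scal scalD quot_projD. Qed.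
Lemma quot_scalM : {morph quot_scal : a b / a * b}.
Proof. by move=> a b; rewrite /quot_scal scalM quot_projM. Qed.
Lemma quot_scal1 : quot_scal 1 = 1.
Proof. by rewrite /quot_scal scal1. Qed.
Lemma quot_scal_central (a : F) (x : Q) : quot_scal a * x = x * quot_scal a.
Proof.
by elim/quot_ind: x => x; rewrite /quot_scal -!quot_projM scal_central.
Qed.
HB.instance Definition _ := PzRing_isAssocAlg.Build F alg_quot
  quot_scalD quot_scalM quot_scal1 quot_scal_central.

Definition quot_alg : assocAlgType F := [the assocAlgType F of alg_quot].

Definition quot_hom : algHom A quot_alg :=
  @AlgHom F A quot_alg quot_proj quot_projD quot_projM (fun=> erefl).

Lemma quot_hom_eq x y : rel (x - y) -> quot_hom x = quot_hom y.
Proof. by move=> H; apply/quot_projP; apply: ideal_gen_rel. Qed.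

Lemma quot_hom_eqMM x y z t : rel (x * y - z * t) ->
  quot_hom x * quot_hom y = quot_hom z * quot_hom t.
Proof. by move=> /quot_hom_eq; rewrite !alg_homM. Qed.

Lemma quot_hom_eqM x y z : rel (x - y * z) ->
  quot_hom x = quot_hom y * quot_hom z.
Proof. by move=> /quot_hom_eq ->; rewrite alg_homM. Qed.

Lemma quot_hom_eq_lin (a : F) x y z : rel (x - (scal a * y + z)) ->
  quot_hom x = scal a * quot_hom y + quot_hom z.
Proof. by move=> /quot_hom_eq ->; rewrite alg_homD alg_homM alg_hom_scal. Qed.

Lemma quot_hom_eq_comm (J : finType) (P : pred J) (k : J -> F) (w : J -> A)
    (a : F) x y :
  rel (y * x - x * y - (scal a - \sum_(i | P i) scal (k i) * w i)) ->
  quot_hom y * quot_hom x - quot_hom x * quot_hom y =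
  scal a - \sum_(i | P i) scal (k i) * quot_hom (w i).
Proof.
move=> /quot_hom_eq; rewrite !alg_homB !alg_homM alg_hom_scal alg_hom_sum => ->.
by congr (_ - _); apply: eq_bigr => i _; rewrite alg_homM alg_hom_scal.
Qed.

Variables (B : assocAlgType F) (f : algHom A B).
Hypothesis f_rel : forall x, rel x -> f x = 0.

Lemma quot_lift_ideal x y : I (x - y) -> f x = f y.
Proof.
move=> /(_ (fun z => f z = 0)) H; apply/eqP; rewrite -subr_eq0 -alg_homB.
apply/eqP/H => //; split=> /= [|a b Ha Hb|a b c Hb].
- by rewrite alg_hom0.
- by rewrite alg_homD Ha Hb addr0.
- by rewrite !alg_homM Hb mulr0 mul0r.
Qed.

Definition quot_eval (q : alg_quot) : B := f (quot_repr q).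

Lemma quot_evalE x : quot_eval (quot_proj x) = f x.
Proof. by apply: quot_lift_ideal; apply: repr_proj. Qed.

Lemma quot_evalD : {morph quot_eval : x y / x + y}.
Proof.
elim/quot_ind=> x; elim/quot_ind=> y.
by rewrite -quot_projD !quot_evalE alg_homD.
Qed.

Lemma quot_evalM : {morph quot_eval : x y / x * y}.
Proof.
elim/quot_ind=> x; elim/quot_ind=> y.
by rewrite -quot_projM !quot_evalE alg_homM.
Qed.

Lemma quot_eval_scal (a : F) : quot_eval (scal a) = scal a.
Proof. by rewrite -(alg_hom_scal f) -quot_evalE. Qed.

Definition quot_lift : algHom quot_alg B :=
  @AlgHom F quot_alg B quot_eval quot_evalD quot_evalM quot_eval_scal.

Lemma quot_liftE x : quot_lift (quot_hom x) = f x.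
Proof. exact: quot_evalE. Qed.

End AlgQuotient.

Record fdRep (F : fieldType) (A : assocAlgType F) := FdRep {
  rep_space : vectType F;
  rep_act : A -> 'End(rep_space);
  rep_actD : {morph rep_act : a b / a + b};
  rep_actM : forall a b, rep_act (a * b) = (rep_act a \o rep_act b)%VF;
  rep_act_scal : forall k : F, rep_act (scal k) = k *: \1%VF
}.

Section Representations.
Variables (F : fieldType) (A : assocAlgType F).

Definition irreducible_rep (V : fdRep A) : Prop :=
  (fullv : {vspace rep_space V}) <> 0%VS /\
  forall U : {vspace rep_space V},
    (forall a : A, (rep_act V a @: U <= U)%VS) -> U = 0%VS \/ U = fullv.

Definition rep_isomorphic (V W : fdRep A) : Prop :=
  exists f : 'Hom(rep_space V, rep_space W),
    bijective f /\ forall a v, f (rep_act V a v) = rep_act W a (f v).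

End Representations.

Section Restriction.
Variables (F : fieldType) (A B : assocAlgType F) (f : algHom A B) (V : fdRep B).

Definition restrict_act (a : A) : 'End(rep_space V) := rep_act V (f a).

Lemma restrict_actD : {morph restrict_act : a b / a + b}.
Proof. by move=> a b; rewrite /restrict_act alg_homD rep_actD. Qed.
Lemma restrict_actM a b :
  restrict_act (a * b) = (restrict_act a \o restrict_act b)%VF.
Proof. by rewrite /restrict_act alg_homM rep_actM. Qed.
Lemma restrict_act_scal (k : F) : restrict_act (scal k) = k *: \1%VF.
Proof. by rewrite /restrict_act alg_hom_scal rep_act_scal. Qed.

Definition rep_restrict : fdRep A :=
  FdRep restrict_actD restrict_actM restrict_act_scal.

End Restriction.

Section Cherednik.
Variables (F : fieldType) (gT : finGroupType) (n : nat).

(* h is the space of column vectors, on which w acts by y |-> rho w *m y, and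
   h^* is the space of row vectors, on which w acts by x |-> x *m rho w^-1. *)
Definition is_reflection (rho : gT -> 'M[F]_n) (s : gT) : bool :=
  \rank (rho s - 1%:M) == 1%N.

Definition pairing (x : 'rV[F]_n) (y : 'cV[F]_n) : F := (x *m y) 0 0.

Definition is_root_pair (rho : gT -> 'M[F]_n) (s : gT)
    (p : 'rV[F]_n * 'cV[F]_n) : Prop :=
  exists lambda : F,
    [/\ lambda != 1, p.1 *m rho s^-1%g = lambda *: p.1,
        rho s *m p.2 = lambda^-1 *: p.2 & pairing p.1 p.2 = 2].

(* A choice of (alpha_s, alpha_s^vee); the tensor alpha_s (x) alpha_s^vee, the
   only thing used below, does not depend on it. *)
Definition root_pair (rho : gT -> 'M[F]_n) (s : gT) : 'rV[F]_n * 'cV[F]_n :=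
  xget (0, 0) [set p | is_root_pair rho s p]%classic.
Definition refl_root rho s := (root_pair rho s).1.
Definition refl_coroot rho s := (root_pair rho s).2.

Variables (G : {group gT}) (rG : mx_representation F G n).

Definition smash_letter : choiceType := ([subg G] + 'rV[F]_n + 'cV[F]_n)%type.
Definition letterW (w : gT) : free_alg F smash_letter :=
  letter F (inl (inl (subg G w)) : smash_letter).
Definition letterX (x : 'rV[F]_n) : free_alg F smash_letter :=
  letter F (inl (inr x) : smash_letter).
Definition letterY (y : 'cV[F]_n) : free_alg F smash_letter :=
  letter F (inr y : smash_letter).

Inductive smash_rel : set (free_alg F smash_letter) :=
| SmashW1 : smash_rel (letterW 1 - 1)
| SmashWM (u v : gT) of u \in G & v \in G :
    smash_rel (letterW (u * v)%g - letterW u * letterW v)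
| SmashXlin (a : F) (x x' : 'rV[F]_n) :
    smash_rel (letterX (a *: x + x') - (scal a * letterX x + letterX x'))
| SmashYlin (a : F) (y y' : 'cV[F]_n) :
    smash_rel (letterY (a *: y + y') - (scal a * letterY y + letterY y'))
| SmashWX (w : gT) (x : 'rV[F]_n) of w \in G :
    smash_rel (letterW w * letterX x - letterX (x *m rG w^-1%g) * letterW w)
| SmashWY (w : gT) (y : 'cV[F]_n) of w \in G :
    smash_rel (letterW w * letterY y - letterY (rG w *m y) * letterW w).

(* The algebra F[G] |x T(h^* (+) h). *)
Definition smash_alg : assocAlgType F := quot_alg smash_rel.
Definition smashW (w : gT) : smash_alg := quot_hom smash_rel (letterW w).
Definition smashX (x : 'rV[F]_n) : smash_alg := quot_hom smash_rel (letterX x).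
Definition smashY (y : 'cV[F]_n) : smash_alg := quot_hom smash_rel (letterY y).

Definition reflections : {set gT} := [set s in G | is_reflection rG s].

Variable c : gT -> F.

Inductive cherednik_rel : set smash_alg :=
| CherednikXX (x x' : 'rV[F]_n) :
    cherednik_rel (smashX x * smashX x' - smashX x' * smashX x)
| CherednikYY (y y' : 'cV[F]_n) :
    cherednik_rel (smashY y * smashY y' - smashY y' * smashY y)
| CherednikYX (y : 'cV[F]_n) (x : 'rV[F]_n) :
    cherednik_rel (smashY y * smashX x - smashX x * smashY y -
      (scal (pairing x y) -
       \sum_(s in reflections)
         scal (c s * pairing (refl_root rG s) y * pairing x (refl_coroot rG s)) *
           smashW s)).

(* H_c(G, h); only the values of c on reflections matter, and c is meant to be
   invariant under conjugation by G. *)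
Definition cherednik : assocAlgType F := quot_alg cherednik_rel.
Definition cherednikW (w : gT) : cherednik := quot_hom cherednik_rel (smashW w).
Definition cherednikX (x : 'rV[F]_n) : cherednik :=
  quot_hom cherednik_rel (smashX x).
Definition cherednikY (y : 'cV[F]_n) : cherednik :=
  quot_hom cherednik_rel (smashY y).

Local Notation q1 := (quot_hom smash_rel).
Local Notation q2 := (quot_hom cherednik_rel).

Lemma cherednikW1 : cherednikW 1 = 1.
Proof.
have /(congr1 q2) H := quot_hom_eq SmashW1.
by rewrite /cherednikW /smashW H !alg_hom1.
Qed.

Lemma cherednikWM u v : u \in G -> v \in G ->
  cherednikW (u * v)%g = cherednikW u * cherednikW v.
Proof. by move=> Gu Gv; apply/alg_hom_eqM/quot_hom_eqM/SmashWM. Qed.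

Lemma cherednikX_lin a x x' :
  cherednikX (a *: x + x') = scal a * cherednikX x + cherednikX x'.
Proof. by apply/alg_hom_eq_lin/quot_hom_eq_lin/SmashXlin. Qed.

Lemma cherednikY_lin a y y' :
  cherednikY (a *: y + y') = scal a * cherednikY y + cherednikY y'.
Proof. by apply/alg_hom_eq_lin/quot_hom_eq_lin/SmashYlin. Qed.

Lemma cherednikWX w x : w \in G ->
  cherednikW w * cherednikX x = cherednikX (x *m rG w^-1%g) * cherednikW w.
Proof. by move=> Gw; apply/alg_hom_eqMM/quot_hom_eqMM/SmashWX. Qed.

Lemma cherednikWY w y : w \in G ->
  cherednikW w * cherednikY y = cherednikY (rG w *m y) * cherednikW w.
Proof. by move=> Gw; apply/alg_hom_eqMM/quot_hom_eqMM/SmashWY. Qed.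

Lemma cherednikXX x x' :
  cherednikX x * cherednikX x' = cherednikX x' * cherednikX x.
Proof. exact/quot_hom_eqMM/CherednikXX. Qed.

Lemma cherednikYY y y' :
  cherednikY y * cherednikY y' = cherednikY y' * cherednikY y.
Proof. exact/quot_hom_eqMM/CherednikYY. Qed.

Lemma cherednikYX y x :
  cherednikY y * cherednikX x - cherednikX x * cherednikY y =
  scal (pairing x y) -
  \sum_(s in reflections)
    scal (c s * pairing (refl_root rG s) y * pairing x (refl_coroot rG s)) * cherednikW s.
Proof.
exact/quot_hom_eq_comm/CherednikYX.
Qed.

Section Lift.
Variables (A : assocAlgType F).
Variables (fW : gT -> A) (fX : 'rV[F]_n -> A) (fY : 'cV[F]_n -> A).

Record cherednik_map : Prop := CherednikMap {
  cmapW1 : fW 1%g = 1;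
  cmapWM : forall u v, u \in G -> v \in G -> fW (u * v)%g = fW u * fW v;
  cmapX_lin : forall a x x', fX (a *: x + x') = scal a * fX x + fX x';
  cmapY_lin : forall a y y', fY (a *: y + y') = scal a * fY y + fY y';
  cmapWX : forall w x, w \in G -> fW w * fX x = fX (x *m rG w^-1%g) * fW w;
  cmapWY : forall w y, w \in G -> fW w * fY y = fY (rG w *m y) * fW w;
  cmapXX : forall x x', fX x * fX x' = fX x' * fX x;
  cmapYY : forall y y', fY y * fY y' = fY y' * fY y;
  cmapYX : forall y x, fY y * fX x - fX x * fY y = scal (pairing x y) -
    \sum_(s in reflections)
      scal (c s * pairing (refl_root rG s) y * pairing x (refl_coroot rG s)) * fW s
}.

Hypothesis fP : cherednik_map.

Definition letter_map (t : smash_letter) : A :=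
  match t with inl (inl u) => fW (sgval u) | inl (inr x) => fX x | inr y => fY y end.

Lemma free_liftW w : w \in G -> free_lift letter_map (letterW w) = fW w.
Proof. by move=> Gw; rewrite free_lift_letter /= subgK. Qed.
Lemma free_liftX x : free_lift letter_map (letterX x) = fX x.
Proof. exact: free_lift_letter. Qed.
Lemma free_liftY y : free_lift letter_map (letterY y) = fY y.
Proof. exact: free_lift_letter. Qed.

Lemma smash_lift_rel p : smash_rel p -> free_lift letter_map p = 0.
Proof.
have sub0 (x y : A) : x = y -> x - y = 0 by move->; rewrite subrr.
case=> [|u v Gu Gv|a x x'|a y y'|w x Gw|w y Gw]; rewrite alg_homB; apply: sub0.
- by rewrite free_liftW // alg_hom1 (cmapW1 fP).
- by rewrite alg_homM !free_liftW ?groupM // (cmapWM fP).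
- by rewrite alg_homD alg_homM alg_hom_scal !free_liftX (cmapX_lin fP).
- by rewrite alg_homD alg_homM alg_hom_scal !free_liftY (cmapY_lin fP).
- rewrite (alg_homM _ (letterW w)) (alg_homM _ (letterX _)) !free_liftX.
  by rewrite !free_liftW // (cmapWX fP).
- rewrite (alg_homM _ (letterW w)) (alg_homM _ (letterY _)) !free_liftY.
  by rewrite !free_liftW // (cmapWY fP).
Qed.

Definition smash_lift : algHom smash_alg A := quot_lift smash_lift_rel.

Lemma smash_liftW w : w \in G -> smash_lift (smashW w) = fW w.
Proof. by move=> Gw; rewrite -free_liftW //; apply: quot_liftE. Qed.
Lemma smash_liftX x : smash_lift (smashX x) = fX x.
Proof. by rewrite -free_liftX; apply: quot_liftE. Qed.
Lemma smash_liftY y : smash_lift (smashY y) = fY y.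
Proof. by rewrite -free_liftY; apply: quot_liftE. Qed.

Lemma cherednik_lift_rel p : cherednik_rel p -> smash_lift p = 0.
Proof.
have sub0 (x y : A) : x = y -> x - y = 0 by move->; rewrite subrr.
case=> [x x'|y y'|y x]; rewrite alg_homB; apply: sub0.
- rewrite (alg_homM _ (smashX x)) (alg_homM _ (smashX x')) !smash_liftX.
  exact: cmapXX.
- rewrite (alg_homM _ (smashY y)) (alg_homM _ (smashY y')) !smash_liftY.
  exact: cmapYY.
rewrite alg_homB (alg_homM _ (smashY y)) (alg_homM _ (smashX x)).
rewrite smash_liftX smash_liftY (cmapYX fP) alg_homB alg_hom_scal alg_hom_sum.
congr (_ - _); apply: eq_bigr => s; rewrite inE => /andP[Gs _].
by rewrite (alg_homM _ (scal _)) alg_hom_scal smash_liftW.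
Qed.

Definition cherednik_lift : algHom cherednik A := quot_lift cherednik_lift_rel.

Lemma cherednik_liftW w : w \in G -> cherednik_lift (cherednikW w) = fW w.
Proof. by move=> Gw; rewrite -smash_liftW //; apply: quot_liftE. Qed.
Lemma cherednik_liftX x : cherednik_lift (cherednikX x) = fX x.
Proof. by rewrite -smash_liftX; apply: quot_liftE. Qed.
Lemma cherednik_liftY y : cherednik_lift (cherednikY y) = fY y.
Proof. by rewrite -smash_liftY; apply: quot_liftE. Qed.

End Lift.

End Cherednik.

(* B_n = S_n |x (Z/2)^n, acting on F^n by
   ((s, e) z)_i = (-1)^(e i) * z_(s i). *)
Record signed_perm (n : nat) := SignedPerm {
  sp_perm : 'S_n;
  sp_sign : {ffun 'I_n -> bool}
}.

Section SignedPerm.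
Variable n : nat.

Definition sp_pair (w : signed_perm n) := (sp_perm w, sp_sign w).
Definition pair_sp (p : 'S_n * {ffun 'I_n -> bool}) := SignedPerm p.1 p.2.
Lemma sp_pairK : cancel sp_pair pair_sp. Proof. by case. Qed.
HB.instance Definition _ := Finite.copy (signed_perm n) (can_type sp_pairK).

Definition sp_mul (w v : signed_perm n) : signed_perm n :=
  SignedPerm (sp_perm w * sp_perm v)%g
    [ffun i => sp_sign w i (+) sp_sign v (sp_perm w i)].
Definition sp_one : signed_perm n := SignedPerm 1%g [ffun=> false].
Definition sp_inv (w : signed_perm n) : signed_perm n :=
  SignedPerm (sp_perm w)^-1%g [ffun i => sp_sign w ((sp_perm w)^-1%g i)].

Lemma signed_perm_eq (w v : signed_perm n) :
  sp_perm w = sp_perm v -> sp_sign w =1 sp_sign v -> w = v.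
Proof. by case: w v => [s e] [t f] /= -> /ffunP ->. Qed.

Lemma sp_mulA : associative sp_mul.
Proof.
move=> u v w; apply: signed_perm_eq => [|i] /=; first by rewrite mulgA.
by rewrite !ffunE permM addbA.
Qed.
Lemma sp_mul1 : left_id sp_one sp_mul.
Proof.
move=> u; apply: signed_perm_eq => [|i] /=; first by rewrite mul1g.
by rewrite !ffunE perm1.
Qed.
Lemma sp_mulV : left_inverse sp_one sp_inv sp_mul.
Proof.
move=> u; apply: signed_perm_eq => [|i] /=; first by rewrite mulVg.
by rewrite !ffunE addbb.
Qed.
HB.instance Definition _ :=
  Finite_isGroup.Build (signed_perm n) sp_mulA sp_mul1 sp_mulV.

Definition Bn : {group signed_perm n} := [set: signed_perm n]%G.

Definition even_sign_changes : {set signed_perm n} :=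
  [set w | ~~ odd #|[set i | sp_sign w i]|].

Lemma odd_sign_changes (w : signed_perm n) :
  odd #|[set i | sp_sign w i]| = \big[addb/false]_i sp_sign w i.
Proof.
rewrite -sum1_card (big_morph odd oddD (erefl _)) big_mkcond.
by apply: eq_bigr => i _; rewrite inE; case: (sp_sign w i).
Qed.

Lemma even_sign_changes_group : group_set even_sign_changes.
Proof.
apply/group_setP; split.
  by rewrite inE odd_sign_changes big1 // => i _; rewrite ffunE.
move=> u v; rewrite !inE !odd_sign_changes => Hu Hv.
rewrite (eq_bigr (fun i => sp_sign u i (+) sp_sign v (sp_perm u i))); last first.
  by move=> i _; rewrite ffunE.
rewrite big_split /= (negbTE Hu) addFb; move: Hv.
by rewrite (reindex_inj (@perm_inj _ (sp_perm u))).
Qed.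

Definition Dn : {group signed_perm n} := Group even_sign_changes_group.

Variable F : fieldType.

Definition sp_mx (w : signed_perm n) : 'M[F]_n :=
  \matrix_(i, j) ((-1) ^+ sp_sign w i * (sp_perm w i == j)%:R).

Lemma sp_mx_repr : mx_repr Bn sp_mx.
Proof.
split=> [|u v _ _]; apply/matrixP => i j; rewrite !mxE.
  by rewrite ffunE perm1 mul1r.
rewrite (bigD1 (sp_perm u i)) //= !mxE eqxx mulr1 big1 ?addr0 => [|k Hk].
  by rewrite ffunE permM signr_addb mulrA.
by rewrite !mxE eq_sym (negbTE Hk) mulr0 mul0r.
Qed.

Definition Bn_repr : mx_representation F Bn n := MxRepresentation sp_mx_repr.
Definition Dn_repr : mx_representation F Dn n := subg_repr Bn_repr (finset.subsetT Dn).

(* The hyperplane fixed by w is z_i = 0 for some i. *)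
Definition coord_reflection (w : signed_perm n) : bool :=
  `[< exists i, forall z : 'cV[F]_n, sp_mx w *m z = z <-> z i 0 = 0 >].

(* The reflections of B_n other than those in z_i = 0 are those in z_i = +/- z_j. *)
Definition Bn_param (c1 c2 : F) (w : signed_perm n) : F :=
  if coord_reflection w then c2 else c1.

Lemma sp_mx_act (w : signed_perm n) (z : 'cV[F]_n) i :
  (sp_mx w *m z) i 0 = (-1) ^+ sp_sign w i * z (sp_perm w i) 0.
Proof.
rewrite mxE (bigD1 (sp_perm w i)) //= big1 => [|l li]; rewrite mxE.
  by rewrite eqxx mulr1 addr0.
by rewrite eq_sym (negbTE li) mulr0 mul0r.
Qed.

Lemma Bn_paramJ (c1 c2 : F) (w v : signed_perm n) :
  Bn_param c1 c2 (w ^ v)%g = Bn_param c1 c2 w.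
Proof.
rewrite /Bn_param; congr (if _ then _ else _).
have mxM u u' : sp_mx (u * u')%g = sp_mx u *m sp_mx u'.
  by have := sp_mx_repr.2 u u'; apply; rewrite inE.
have mxK u z : sp_mx u^-1%g *m (sp_mx u *m z) = z :> 'cV[F]_n.
  by rewrite mulmxA -mxM mulVg sp_mx_repr.1 mul1mx.
have imp x u : coord_reflection x -> coord_reflection (x ^ u)%g.
  move=> /asboolP[i fix_i]; apply/asboolP; exists (sp_perm u i) => z.
  have zE : (sp_mx u *m z) i 0 = 0 <-> z (sp_perm u i) 0 = 0.
    rewrite sp_mx_act; split=> [/eqP|->]; last by rewrite mulr0.
    by rewrite mulf_eq0 signr_eq0 => /eqP.
  apply: iff_trans zE; apply: iff_trans (fix_i _).
  rewrite /conjg !mxM -!mulmxA; split=> [H | ->]; last exact: mxK.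
  rewrite -[in RHS]H; have := mxK u^-1%g (sp_mx x *m (sp_mx u *m z)).
  by rewrite invgK.
by apply/idP/idP => [/(imp _ v^-1%g)|/imp//]; rewrite conjgK.
Qed.

Definition cherednik_B (c1 c2 : F) : assocAlgType F :=
  cherednik Bn_repr (Bn_param c1 c2).
Definition cherednik_D (c : F) : assocAlgType F := cherednik Dn_repr (fun=> c).

Lemma rank1_minor m p (A : 'M[F]_(m, p)) i j k l :
  \rank A = 1%N -> A i j * A k l = A i l * A k j.
Proof.
move=> rA; rewrite -(mulmx_base A) !mxE.
move: (col_base A) (row_base A); rewrite rA => u v.
by rewrite !big_ord1; ring.
Qed.

Lemma sp_mxB1 (w : signed_perm n) i j :
  (sp_mx w - 1%:M) i j =
  (-1) ^+ sp_sign w i * (sp_perm w i == j)%:R - (i == j)%:R.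
Proof. by rewrite !mxE. Qed.

Hypothesis two_neq0 : (2 : F) != 0.

Lemma reflection_cases (w : signed_perm n) :
  is_reflection sp_mx w -> coord_reflection w \/ w \in Dn.
Proof.
move=> /eqP rk; set s := sp_perm w; set e := sp_sign w.
have minor i j k l := @rank1_minor _ _ _ i j k l rk.
have m2 : -1 - 1 != 0 :> F by rewrite -opprD oppr_eq0 -mulr2n.
case: (pickP (fun i => s i != i)) => [i si | s1].
  right; rewrite inE odd_sign_changes.
  have Aii : (sp_mx w - 1%:M) i i = -1.
    by rewrite sp_mxB1 (negbTE si) mulr0 sub0r eqxx.
  have fixk k : k != i -> k != s i -> s k = k /\ e k = false.
    move=> ki ksi; have := minor k k i i; rewrite Aii.
    have -> : (sp_mx w - 1%:M) i k = 0.
      by rewrite sp_mxB1 eq_sym (negbTE ksi) mulr0 eq_sym (negbTE ki) subr0.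
    rewrite mulr0 mulrN1 => /eqP; rewrite oppr_eq0 sp_mxB1 eqxx -/s -/e.
    case: (eqVneq (s k) k) => [-> | _]; last first.
      by rewrite mulr0 sub0r oppr_eq0 oner_eq0.
    by case: (e k) => //; rewrite mulr1 expr1 (negbTE m2).
  have ssi : s (s i) = i.
    apply/eqP/negPn/negP => ssi.
    have nsi : s (s i) != s i by rewrite (inj_eq perm_inj).
    have [H _] := fixk _ ssi nsi.
    by move/perm_inj: H => /eqP; rewrite (negbTE nsi).
  have Ajj : (sp_mx w - 1%:M) (s i) (s i) = -1.
    by rewrite sp_mxB1 -/s ssi [i == s i]eq_sym (negbTE si) mulr0 sub0r eqxx.
  have := minor i i (s i) (s i); rewrite Aii Ajj !sp_mxB1 -/s -/e ssi !eqxx.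
  rewrite [i == s i]eq_sym (negbTE si) !subr0 !mulr1 -signr_addb mulrNN mulr1.
  move=> He; rewrite (bigD1 i) //= (bigD1 (s i)) //= big1 ?addbF.
    rewrite -/e; move: He; case: (e i (+) e (s i)) => // /eqP.
    by rewrite expr1 -subr_eq0 opprK -mulr2n (negbTE two_neq0).
  by move=> k /andP[ki ksi]; case: (fixk k).
left; apply/asboolP.
have sE k : s k = k by apply/eqP; have := s1 k; case: eqP.
have AE i j : (sp_mx w - 1%:M) i j = (if e i then -1 - 1 else 0) * (i == j)%:R.
  rewrite sp_mxB1 -/s -/e sE; case: (e i); rewrite ?expr0 ?expr1; ring.
have [i ei] : exists i, e i.
  case: (pickP (fun i => e i)) => [i ei | e0]; first by exists i.
  have A0 : sp_mx w - 1%:M = 0.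
    by apply/matrixP => i j; have ei0 : e i = false := e0 i; rewrite AE ei0 mul0r mxE.
  by move: rk; rewrite A0 mxrank0.
have ek k : k != i -> e k = false.
  move=> ki; have := minor i i k k; rewrite !AE ei !eqxx !mulr1 (negbTE ki).
  rewrite !mulr0 => /eqP; rewrite mulf_eq0 (negbTE m2) /=.
  by case: (e k) => //; rewrite (negbTE m2).
exists i => z; have wE : sp_mx w *m z = z <-> (sp_mx w - 1%:M) *m z = 0.
  by rewrite mulmxBl mul1mx; split=> [->|/eqP]; rewrite ?subrr ?subr_eq0 // => /eqP.
have AzE k : ((sp_mx w - 1%:M) *m z) k 0 = (if e k then -1 - 1 else 0) * z k 0.
  rewrite mxE (bigD1 k) //= big1 => [|l lk]; first by rewrite AE eqxx mulr1 addr0.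
  by rewrite AE eq_sym (negbTE lk) mulr0 mul0r.
split=> [/wE /matrixP /(_ i 0) | zi].
  by rewrite AzE ei mxE => /eqP; rewrite mulf_eq0 (negbTE m2) => /eqP.
apply/wE/matrixP => k l; rewrite ord1 AzE mxE.
by case: (eqVneq k i) => [-> | ki]; [rewrite zi mulr0 | rewrite ek ?mul0r].
Qed.

Lemma coord_reflection_odd (w : signed_perm n) :
  coord_reflection w -> w \notin Dn.
Proof.
move=> /asboolP[i fix_i]; set s := sp_perm w; set e := sp_sign w.
have wE (z : 'cV[F]_n) k : (sp_mx w *m z) k 0 = (-1) ^+ e k * z (s k) 0.
  rewrite mxE (bigD1 (s k)) //= big1 => [|l lk]; rewrite mxE -/s.
    by rewrite eqxx mulr1 addr0.
  by rewrite eq_sym (negbTE lk) mulr0 mul0r.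
have fix_k k : k != i -> s k = k /\ e k = false.
  move=> ki; have d0 : (delta_mx k 0 : 'cV[F]_n) i 0 = 0.
    by rewrite mxE eq_sym (negbTE ki).
  have /matrixP/(_ k 0) := (fix_i _).2 d0; rewrite wE !mxE !eqxx andbT; case: (eqVneq (s k) k) => [-> | _] /eqP.
    case: (e k) => //; rewrite mulr1 expr1 eq_sym -subr_eq0 opprK -mulr2n.
    by rewrite (negbTE two_neq0).
  by rewrite mulr0 eq_sym oner_eq0.
have si : s i = i.
  apply/eqP/negPn/negP => nsi; have [/perm_inj /eqP] := fix_k _ nsi.
  by rewrite (negbTE nsi).
rewrite inE negbK odd_sign_changes (bigD1 i) //= big1 ?addbF => [|k ki]; last first.
  by case: (fix_k k ki).
rewrite -/e; case ei: (e i) => //.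
have /fix_i : sp_mx w *m delta_mx i 0 = delta_mx i 0 :> 'cV[F]_n.
  apply/matrixP => k l; rewrite ord1 wE.
  case: (eqVneq k i) => [-> | ki]; first by rewrite ei si mul1r.
  by have [-> ->] := fix_k k ki; rewrite mul1r.
by rewrite mxE !eqxx => /eqP; rewrite oner_eq0.
Qed.

Lemma reflections_BnDn : reflections Dn_repr =
  [set s in reflections Bn_repr | ~~ coord_reflection s].
Proof.
apply/setP => s; rewrite [in RHS]inE !(inE, in_setI) /=.
apply/idP/idP => [/andP[Ds rs] | /andP[rs cs]].
  rewrite rs /=; apply/negP => /coord_reflection_odd; rewrite inE.
  by rewrite Ds.
by have [H|] := reflection_cases rs; [rewrite H in cs|rewrite inE => ->].
Qed.

Lemma sum_reflections_BnDn (A : assocAlgType F) (c : F) (k l : signed_perm n -> F)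
    (w : signed_perm n -> A) :
  \sum_(s in reflections Bn_repr) scal (Bn_param c 0 s * k s * l s) * w s =
  \sum_(s in reflections Dn_repr) scal (c * k s * l s) * w s.
Proof.
have DnE s : (s \in reflections Dn_repr) =
    (s \in reflections Bn_repr) && ~~ coord_reflection s.
  by rewrite reflections_BnDn inE.
rewrite [RHS](eq_bigl _ _ DnE) [RHS]big_mkcondr.
apply: eq_bigr => s _; rewrite /Bn_param; case: coord_reflection => //=.
by rewrite !mul0r assoc_scal0 mul0r.
Qed.

Lemma embed_cherednik_map (c : F) :
  cherednik_map Dn_repr (fun=> c) (cherednikW Bn_repr (Bn_param c 0))
    (cherednikX Bn_repr (Bn_param c 0)) (cherednikY Bn_repr (Bn_param c 0)).
Proof.
have DB u : u \in Dn -> u \in Bn by move=> _; rewrite inE.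
split.
- exact: cherednikW1.
- by move=> u v /DB Bu /DB Bv; apply: cherednikWM.
- exact: cherednikX_lin.
- exact: cherednikY_lin.
- by move=> w x /DB; apply: cherednikWX.
- by move=> w y /DB; apply: cherednikWY.
- exact: cherednikXX.
- exact: cherednikYY.
move=> y x; have := sum_reflections_BnDn c
  (fun s => pairing (refl_root Bn_repr s) y) (fun s => pairing x (refl_coroot Bn_repr s))
  (cherednikW Bn_repr (Bn_param c 0)).
by move=> <-; apply: cherednikYX.
Qed.

End SignedPerm.

Lemma complex_two_neq0 (R : realType) : (2 : R[i]) != 0.
Proof. by rewrite Num.Theory.pnatr_eq0. Qed.

(* The algebra morphism H_c(D_n, C^n) -> H_(c,0)(B_n, C^n) induced by the
   inclusion of D_n in B_n and the identities of h and h^*. *)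
Definition cherednik_DB (R : realType) (n : nat) (c : R[i]) :
    algHom (cherednik_D n c) (cherednik_B n c 0) :=
  cherednik_lift (embed_cherednik_map n (complex_two_neq0 R) c).

Section CherednikDB.
Variables (R : realType) (n : nat) (c : R[i]).
Local Notation D_repr := (Dn_repr n R[i]).
Local Notation B_repr := (Bn_repr n R[i]).

Lemma cherednik_DBW w : w \in Dn n ->
  cherednik_DB n c (cherednikW D_repr (fun=> c) w) =
  cherednikW B_repr (Bn_param c 0) w.
Proof. exact: cherednik_liftW. Qed.

Lemma cherednik_DBX x :
  cherednik_DB n c (cherednikX D_repr (fun=> c) x) =
  cherednikX B_repr (Bn_param c 0) x.
Proof. exact: cherednik_liftX. Qed.

Lemma cherednik_DBY y :
  cherednik_DB n c (cherednikY D_repr (fun=> c) y) =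
  cherednikY B_repr (Bn_param c 0) y.
Proof. exact: cherednik_liftY. Qed.

End CherednikDB.

(* Main.v *)
Require Import Defs.
From HB Require Import structures.
From mathcomp Require Import all_boot all_algebra all_fingroup.
From mathcomp Require Import all_character.
From mathcomp Require Import boolp classical_sets reals complex monalg ring.

Set Implicit Arguments.
Unset Strict Implicit.
Unset Printing Implicit Defensive.

Import GRing.Theory Num.Theory.
Local Open Scope ring_scope.

(** Let t be the sign change of one coordinate, an element of B_n outside D_n.
Since B_n is generated by D_n and t, and the reflections in the coordinate
hyperplanes have coefficient 0 in the commutators [y, x], a module over
H_(c,0)(B_n) is a module V over H_c(D_n) with an involution S such that
S h = h^t S for all h. If V is irreducible and finite dimensional and S is an
isomorphism from V to its twist V^t, then S^2 is a scalar by Schur's lemma, and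
S can be rescaled to an involution ([twist_involution], [extended_action]). So
everything rests on V being isomorphic to V^t.

The Euler element [euler] acts on V diagonalizably with eigenvalues in
a0, a0 + 1, ..., the elements y kill the lowest eigenspace V0, and W = D_n acts
on it ([grading_exists]). A nonzero W-map phi from V0 to its twist spreads to V
by the action of the elements x, because the submodule of V + V^t generated by
its graph projects onto V and meets V^t trivially: it is the graph of a nonzero
map ([twist_matrix]).

It remains to find phi, and this is where finite dimension is decisive. Let
  g_w(z) = tr_V(w z^(eu - a0)),   D_w(z) = det(1 - z w^-1),   G_w = g_w D_w,
which are polynomials in z. Moving an element x around the trace expresses
tr(w x_i y_j z^(eu - a0)) through the g_(ws), s a reflection, and the adjugate
of 1 - z w^-1; with Jacobi's formula and the rank one update of determinants
this becomes ([normalized_trace_ode])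
  z G_w' = - a0 G_w - c sum_s G_(ws).
Put f(w) = chi(w^-1) - chi(t w^-1 t) for the character chi of V0. As c sum_s s
is central and acts on V0 by -a0, the function f is an eigenfunction of the
transposed operator, hence sum_w f(w) G_w has zero derivative and takes the same
value at z = 0 and at z = 1. At z = 1 every term vanishes: if D_w(1) is not
zero, then w has no fixed vector, so all its cycles are negative, each of them
is an odd element of B_n commuting with w, and w^-1 and t w^-1 t are conjugate
in D_n ([odd_centralizer]), so that f(w) = 0. At z = 0 the sum is
sum_w f(w) chi(w) ([twist_defect_orthogonal]). Thus sum_w chi(t w^-1 t) chi(w)
equals sum_w chi(w^-1) chi(w), which is |W| dim End_W(V0) and not zero
([trace_average_neq0]); the left side would be zero if there were no phi. *)

Local Notation "M ^%:P" := (map_mx polyC M) (at level 2, format "M ^%:P").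

(** * Determinants, traces and ranks *)

Lemma deriv_prod (R : comNzRingType) (I : finType) (p : I -> {poly R}) :
  (\prod_i p i)^`() = \sum_i (p i)^`() * \prod_(j | j != i) p j.
Proof.
suff H (s : seq I) : uniq s -> (\prod_(i <- s) p i)^`() =
    \sum_(i <- s) (p i)^`() * \prod_(j <- s | j != i) p j.
  by have := H (index_enum I) (index_enum_uniq I).
elim: s => [|a s IH] /=; first by rewrite !big_nil derivC.
move=> /andP[as_ us]; rewrite !big_cons derivM IH // eqxx /=; congr (_ * _ + _).
  rewrite [LHS]big_seq_cond [RHS]big_seq_cond; apply: eq_bigl => j.
  rewrite andbT; case: (boolP (j \in s)) => //= js; symmetry.
  by apply/eqP => ja; rewrite -ja js in as_.
rewrite mulr_sumr big_seq [RHS]big_seq; apply: eq_bigr => i is_.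
rewrite big_cons; case: eqP => [ai|_]; first by rewrite ai is_ in as_.
by rewrite !mulrA [p a * _]mulrC.
Qed.

(** Jacobi's formula: differentiating one row at a time, each determinant obtained
    is expanded along the differentiated row. *)
Lemma deriv_det (R : comNzRingType) n (M : 'M[{poly R}]_n) :
  (\det M)^`() = \tr (\adj M *m map_mx (@deriv R) M).
Proof.
rewrite mxtrace_mulC /mxtrace.
transitivity (\sum_i \det (\matrix_(k, j) if k == i then (M k j)^`() else M k j)).
  rewrite /determinant (raddf_sum (@deriv R)) exchange_big /=; apply: eq_bigr => s _.
  rewrite -mulr_sumr -signr_odd; set S := \sum_i _.
  have -> : S = (\prod_i M i (s i))^`().
    rewrite deriv_prod; apply: eq_bigr => i _.
    rewrite (bigD1 i) //= mxE eqxx; congr (_ * _); apply: eq_bigr => j ji.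
    by rewrite mxE (negbTE ji).
  by case: (odd s); rewrite ?mulN1r ?mul1r ?derivN.
apply: eq_bigr => i _; rewrite mxE (expand_det_row _ i); apply: eq_bigr => j _.
rewrite !mxE eqxx; congr (_ * _); rewrite /cofactor; congr (_ * \det _).
by apply/matrixP => a b; rewrite !mxE eq_sym (negbTE (neq_lift _ _)).
Qed.

(** Both sides are determinants of products of one and the same bordered matrix
    with a block triangular matrix. *)
Lemma det_scalar_add_rank1 (R : idomainType) n (a : R) (u : 'cV[R]_n) (v : 'rV[R]_n) :
  a != 0 -> a * \det (a%:M + u *m v) = a ^+ n * (a + (v *m u) 0 0).
Proof.
move=> a0; have E1 : block_mx (a%:M : 'M_n) (- u) v 1%:M *m block_mx 1%:M 0 (- v) 1%:M
   = block_mx (a%:M + u *m v) (- u) 0 (1%:M : 'M_1).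
  rewrite mulmx_block !mulmx1 !mulmx0 !mul1mx !add0r mulNmx mulmxN opprK.
  by rewrite subrr.
have E2 : block_mx (a%:M : 'M_n) (- u) v 1%:M *m block_mx 1%:M u 0 a%:M
   = block_mx a%:M 0 v (v *m u + a%:M).
  rewrite mulmx_block !mulmx1 !mulmx0 !addr0 mul1mx mul_scalar_mx mul_mx_scalar.
  by rewrite scalerN subrr.
have := congr1 determinant E1; rewrite det_mulmx det_lblock det_ublock !det1 !mulr1 => <-.
have := congr1 determinant E2; rewrite det_mulmx det_lblock det_ublock !det1 !mul1r.
rewrite !det_scalar det_mx11 expr1 !mxE eqxx => E.
by rewrite mulrC E addrC.
Qed.

(** After multiplication by the adjugate of M this is [det_scalar_add_rank1]; the
    power of det M cancels in an integral domain. *)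
Lemma det_add_rank1 (R : idomainType) n (M : 'M[R]_n) (u : 'cV[R]_n) (v : 'rV[R]_n) :
  \det M != 0 -> \det (M + u *m v) = \det M + \tr (\adj M *m (u *m v)).
Proof.
move=> D0; have Dn0 : \det M ^+ n != 0 by rewrite expf_neq0.
apply: (mulfI Dn0).
have := det_scalar_add_rank1 (\adj M *m u) v D0.
have -> : (\det M)%:M + \adj M *m u *m v = \adj M *m (M + u *m v).
  by rewrite mulmxDr mul_adj_mx mulmxA.
rewrite det_mulmx mulrA; have -> : \det M * \det (\adj M) = \det M ^+ n.
  by rewrite -det_mulmx mul_mx_adj det_scalar.
move=> ->; rewrite [\adj M *m (u *m v)]mulmxA [\tr (_ *m v)]mxtrace_mulC.
by rewrite /mxtrace big_ord1.
Qed.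

(** For a rank factorization E = C B, idempotence forces B C = 1, and the trace of
    C B is that of B C. *)
Lemma mxtrace_idempotent (F : fieldType) n (E : 'M[F]_n) :
  E *m E = E -> \tr E = (\rank E)%:R.
Proof.
move=> EE; have fc : row_free (col_base E)^T.
  by rewrite /row_free mxrank_tr; exact: col_base_full.
have fr : row_free (row_base E) by rewrite row_base_free.
move: fc fr (mulmx_base E); move: (col_base E) (row_base E) => C B fc fr CB.
rewrite -[in LHS]CB mxtrace_mulC.
suff -> : B *m C = 1%:M by rewrite mxtrace1.
apply: (row_free_inj fr); rewrite mul1mx; apply: trmx_inj; apply: (row_free_inj fc).
by rewrite -!trmx_mul !mulmxA CB -mulmxA CB EE.
Qed.

Lemma rank1_sandwich (F : fieldType) n (A : 'M[F]_n) (u : 'cV_n) (v : 'rV_n) :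
  \rank A = 1%N -> A *m u *m (v *m A) = (v *m A *m u) 0 0 *: A.
Proof.
move=> rA; rewrite -(mulmx_base A); move: (col_base A) (row_base A).
rewrite rA => a b; rewrite !mulmxA -[a *m b *m u]mulmxA -[_ *m v]mulmxA.
rewrite -[_ *m a *m b]mulmxA -!mulmxA.
rewrite [b *m (u *m _)]mulmxA [v *m (a *m b)]mulmxA [v *m (a *m _)]mulmxA.
rewrite [v *m a]mx11_scalar [b *m u]mx11_scalar !mul_scalar_mx -!scalemxAr.
by rewrite scalerA !mxE eqxx mulr1n mulrC.
Qed.

Lemma rank1_sqr (F : fieldType) n (A : 'M[F]_n) :
  \rank A = 1%N -> A *m A = \tr A *: A.
Proof.
move=> rA; apply/matrixP => i j; rewrite !mxE mulr_suml; apply: eq_bigr => l _.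
by rewrite (rank1_minor _ _ _ _ rA) mulrC.
Qed.

Lemma map_polyC_sum (R : nzRingType) (I : finType) (P : pred I) p q
    (A : I -> 'M[R]_(p, q)) :
  (\sum_(i | P i) A i)^%:P = \sum_(i | P i) (A i)^%:P.
Proof. exact: raddf_sum. Qed.

Lemma mxtrace_sum (R : pzSemiRingType) (I : finType) (P : pred I) p
    (A : I -> 'M[R]_p) :
  \tr (\sum_(i | P i) A i) = \sum_(i | P i) \tr (A i).
Proof. exact: raddf_sum. Qed.

Lemma mxtrace_lin_mx (R : comNzRingType) p q
    (f : {linear 'M[R]_(p, q) -> 'M[R]_(p, q)}) :
  \tr (lin_mx f) = \sum_i \sum_j f (delta_mx i j) i j.
Proof.
rewrite /mxtrace pair_bigA (reindex _ (curry_mxvec_bij _ _)) /=.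
apply: eq_bigr => -[i j] _ /=.
by rewrite -[RHS]mxvecE -mul_vec_lin mxvec_delta -rowE [RHS]mxE.
Qed.

Lemma mulmx_col_ext (F : fieldType) p m (A B : 'M[F]_(p, m)) :
  (forall v : 'cV_m, A *m v = B *m v) -> A = B.
Proof.
move=> E; apply/matrixP => i j; have := E (delta_mx j 0).
by rewrite -!colE => /matrixP /(_ i 0); rewrite !mxE.
Qed.

Lemma neq0_col (F : fieldType) p m (A : 'M[F]_(p, m)) :
  A != 0 -> exists v : 'cV_m, A *m v != 0.
Proof.
move=> A0; apply: contrapT => noV; case/eqP: A0; apply: mulmx_col_ext => v.
by rewrite mul0mx; apply: contrapT => /eqP Av; apply: noV; exists v.
Qed.

(** Submodules are handled as predicates on column vectors, which can be defined by
    induction or impredicatively. *)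
Definition lin_pred (F : fieldType) m (P : 'cV[F]_m -> Prop) : Prop :=
  P 0 /\ forall a u v, P u -> P v -> P (a *: u + v).

Lemma lin_pred_eq (F : fieldType) p m (Z1 Z2 : 'M[F]_(p, m)) :
  lin_pred (fun v => Z1 *m v = Z2 *m v).
Proof.
by split=> [|a u v Eu Ev]; rewrite ?mulmx0 // !mulmxDr -!scalemxAr Eu Ev.
Qed.

(** The subspace is one of maximal dimension among those contained in P. *)
Lemma vspace_of_pred (F : fieldType) (vT : vectType F) (P : vT -> Prop) :
  P 0 -> (forall a u v, P u -> P v -> P (a *: u + v)) ->
  exists U : {vspace vT}, forall v, v \in U <-> P v.
Proof.
move=> P0 PD; pose inP (U : {vspace vT}) := forall v, v \in U -> P v.
pose q k := `[< exists2 U, inP U & \dim U = k >].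
have q0 : exists k, q k.
  exists 0%N; apply/asboolP; exists 0%VS; last exact: dimv0.
  by move=> v; rewrite memv0 => /eqP ->.
have qmax k : q k -> (k <= \dim {:vT})%N.
  by move=> /asboolP[U _ <-]; apply/dimvS/subvf.
have [k /asboolP[U UP dU] kmax] := ex_maxnP q0 qmax.
exists U => v; split=> [|Pv]; first exact: UP.
have UvP : inP (U + <[v]>)%VS.
  move=> _ /memv_addP[u uU [_ /vlineP[a ->] ->]].
  by rewrite addrC; apply: PD => //; apply: UP.
have := kmax (\dim (U + <[v]>)); rewrite -dU => dmax.
have /dmax le : q (\dim (U + <[v]>)) by apply/asboolP; exists (U + <[v]>)%VS.
have /eqP -> : U == (U + <[v]>)%VS by rewrite eqEdim addvSl.
by apply: (subvP (addvSr U _)); apply: memv_line.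
Qed.

(** * The operator t^e of a diagonalizable matrix e *)

Lemma deriv0_const (R : numDomainType) (p : {poly R}) : p^`() = 0 -> p.[1] = p.[0].
Proof.
move=> dp; have -> : p = (p`_0)%:P; last by rewrite !hornerC.
apply/polyP => -[|i]; rewrite coefC //=.
have /eqP := congr1 (fun q : {poly R} => q`_i) dp.
by rewrite coef_deriv coef0 mulrn_eq0 => /eqP.
Qed.

(** Otherwise a, a - 1, a - 2, ... would all be roots. *)
Lemma minimal_root (F : numClosedFieldType) (p : {poly F}) : (1 < size p)%N ->
  exists2 a, root p a & ~~ root p (a - 1).
Proof.
move=> sp; have [a pa] : exists a, root p a.
  by apply/closed_rootP; rewrite neq_ltn sp orbT.
have p0 : p != 0 by rewrite -size_poly_gt0 (ltn_trans _ sp).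
apply: contrapT => noroot.
have H k : root p (a - k%:R).
  elim: k => [|k IH]; first by rewrite subr0.
  apply/negPn/negP => nr; apply: noroot; exists (a - k%:R) => //.
  by rewrite -addrA -opprD natr1.
pose rs := [seq a - k%:R | k <- iota 0 (size p)].
have : (size rs < size p)%N; last by rewrite size_map size_iota ltnn.
apply: max_poly_roots => //; first by apply/allP => _ /mapP[k _ ->].
rewrite map_inj_uniq ?iota_uniq // => i j /addrI /oppr_inj /eqP.
by rewrite eqr_nat => /eqP.
Qed.

Lemma horner_mx_eigen (F : fieldType) m (e : 'M[F]_m.+1) (b : F) (v : 'cV_m.+1) p :
  e *m v = b *: v -> horner_mx e p *m v = p.[b] *: v.
Proof.
move=> ev; elim/poly_ind: p => [|p a IH]; first by rewrite rmorph0 mul0mx horner0 scale0r.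
rewrite rmorphD rmorphM /= horner_mx_X horner_mx_C mulmxDl -[_ * e]/(_ *m e).
by rewrite -mulmxA ev -scalemxAr IH scalerA mul_scalar_mx !hornerE scalerDl mulrC.
Qed.

Lemma char_poly_eigenvector (F : fieldType) m (e : 'M[F]_m) b :
  root (char_poly e) b <-> exists2 v : 'cV_m, v != 0 & e *m v = b *: v.
Proof.
have -> : char_poly e = char_poly e^T.
  by rewrite /char_poly -det_tr /char_poly_mx linearB /= tr_scalar_mx map_trmx.
rewrite -eigenvalue_root_char; split.
  move=> /eigenvalueP[v ev v0]; exists v^T; first by rewrite trmx_eq0.
  by apply: trmx_inj; rewrite trmx_mul trmxK ev linearZ /= trmxK.
move=> [v v0 ev]; apply/eigenvalueP; exists v^T; last by rewrite trmx_eq0.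
by rewrite -trmx_mul ev linearZ.
Qed.

(** The product of the X - b, over the eigenvalues b in S, annihilates e, since it
    kills a spanning set; its roots are simple. *)
Lemma diagonalize_spanned (F : closedFieldType) m (e : 'M[F]_m) (S : F -> Prop) :
  (forall P, lin_pred P -> (forall b v, S b -> e *m v = b *: v -> P v) ->
     forall v, P v) ->
  exists P d, [/\ P \in unitmx, e = invmx P *m diag_mx d *m P & forall j, S (d 0 j)].
Proof.
case: m e => [|m] e spanned.
  exists 1%:M, 0; split; [exact: unitmx1|by apply/matrixP; case|by case].
have [r er] := closed_field_poly_normal (char_poly e).
pose rs := [seq x <- undup r | `[< S x >]].
pose q := \prod_(x <- rs) ('X - x%:P).
have q0 : horner_mx e q = 0.
  apply: mulmx_col_ext => v; rewrite mul0mx; move: v; apply: spanned.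
    by split=> [|a u v Pu Pv]; rewrite ?mulmx0 // mulmxDr -scalemxAr Pu Pv scaler0 addr0.
  move=> b v Sb ev; rewrite (horner_mx_eigen _ ev).
  case: (eqVneq v 0) => [->|v0]; first by rewrite scaler0.
  have : root (char_poly e) b by apply/char_poly_eigenvector; exists v.
  rewrite er rootZ ?root_prod_XsubC; last first.
    by rewrite (eqP (char_poly_monic e)) oner_eq0.
  move=> br; have : root q b.
    by rewrite root_prod_XsubC mem_filter mem_undup br andbT; apply/asboolP.
  by move=> /rootP ->; rewrite scale0r.
have /diagonalizableP : exists2 rs, uniq rs & mxminpoly e %| \prod_(x <- rs) ('X - x%:P).
  by exists rs; [rewrite filter_uniq ?undup_uniq|apply/mxminpoly_minP].
move=> [P Pu /diagonalizable_forPex[d /(simmxLR Pu) ed]]; exists P, d.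
have {}ed : e = invmx P *m diag_mx d *m P by rewrite [LHS]ed mxpoly.conjVmx.
split=> // j; suff : d 0 j \in rs by rewrite mem_filter => /andP[/asboolP].
have Pd : e *m (invmx P *m (delta_mx j 0 : 'cV_m.+1)) =
    d 0 j *: (invmx P *m delta_mx j 0).
  rewrite ed mulmxA mulmxK // -mulmxA scalemxAr; congr (_ *m _).
  by apply/matrixP => i k; rewrite mul_diag_mx !mxE; case: eqP => [->//|]; rewrite !mulr0.
have := horner_mx_eigen q Pd; rewrite q0 mul0mx => /esym/eqP; rewrite scaler_eq0.
case/orP => [qd|/eqP E]; first by rewrite -root_prod_XsubC.
have : delta_mx j 0 = 0 :> 'cV[F]_m.+1 by rewrite -[LHS](mulKVmx Pu) E mulmx0.
by move=> /matrixP /(_ j 0); rewrite !mxE !eqxx => /eqP; rewrite oner_eq0.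
Qed.

Section GradingOperator.
Variables (F : numFieldType) (m : nat) (P : 'M[F]_m) (k : 'I_m -> nat) (a0 : F).
Hypothesis Pu : P \in unitmx.
Let e : 'M[F]_m := invmx P *m diag_mx (\row_j (a0 + (k j)%:R)) *m P.

(** With e = P^-1 diag(a0 + k_j) P, this is z^(e - a0), the variable of the
    polynomials being z. *)
Definition grade_mx : 'M[{poly F}]_m :=
  (invmx P)^%:P *m diag_mx (\row_j 'X^(k j)) *m P^%:P.

Let PPV : P^%:P *m (invmx P)^%:P = 1%:M.
Proof. by rewrite -map_mxM mulmxV // map_mx1. Qed.

Lemma grade_mx_conj (Z : 'M[F]_m) (p q : {poly F}) :
  (forall i j, (P *m Z *m invmx P) i j != 0 -> p * 'X^(k i) = q * 'X^(k j)) ->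
  p *: (grade_mx *m Z^%:P) = q *: (Z^%:P *m grade_mx).
Proof.
move=> kZ; rewrite /grade_mx; set D := diag_mx _.
have -> : Z^%:P = (invmx P)^%:P *m (P *m Z *m invmx P)^%:P *m P^%:P.
  by rewrite -!map_mxM -!mulmxA mulVmx // mulmx1 !mulmxA mulVmx // mul1mx.
move: kZ; move: (P *m Z *m _) => Z' kZ.
have DZ : p *: (D *m Z'^%:P) = q *: (Z'^%:P *m D).
  apply/matrixP => i j; rewrite /D mul_diag_mx mul_mx_diag !mxE.
  have [->|nz] := eqVneq (Z' i j) 0; first by rewrite polyC0 !(mulr0, mul0r).
  by rewrite [_ * 'X^(k j)]mulrC !mulrA (kZ _ _ nz).
transitivity ((invmx P)^%:P *m (p *: (D *m Z'^%:P)) *m P^%:P).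
  rewrite -scalemxAr -scalemxAl !mulmxA.
  by rewrite -[_ *m P^%:P *m (invmx P)^%:P]mulmxA PPV mulmx1.
rewrite DZ -scalemxAr -scalemxAl !mulmxA.
by rewrite -[_ *m P^%:P *m (invmx P)^%:P]mulmxA PPV mulmx1.
Qed.

(** Conjugation by z^e multiplies an eigenvector of ad e of eigenvalue j - i by
    z^(j - i); two exponents make the statement free of negative powers. *)
Lemma grade_mx_shift (Z : 'M[F]_m) (i j : nat) :
  e *m Z + i%:R *: Z = Z *m e + j%:R *: Z ->
  'X^i *: (grade_mx *m Z^%:P) = 'X^j *: (Z^%:P *m grade_mx).
Proof.
move=> eZ; apply: grade_mx_conj => r s nz; rewrite -!exprD; congr ('X^ _).
set Z' := P *m Z *m invmx P in nz *; set d := diag_mx (\row_j (a0 + (k j)%:R)).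
have Pe : d *m P = P *m e by rewrite /e !mulmxA mulmxV // mul1mx.
have eP : invmx P *m d = e *m invmx P by rewrite /e mulmxK.
have : d *m Z' + i%:R *: Z' = Z' *m d + j%:R *: Z'.
  transitivity (P *m (e *m Z + i%:R *: Z) *m invmx P).
    by rewrite /Z' !mulmxA Pe mulmxDr mulmxDl -scalemxAr -scalemxAl !mulmxA.
  rewrite eZ /Z' -[_ *m invmx P *m d]mulmxA eP.
  by rewrite mulmxDr mulmxDl -scalemxAr -scalemxAl !mulmxA.
clearbody Z'; move=> /matrixP /(_ r s); rewrite /d mul_diag_mx mul_mx_diag !mxE.
rewrite [Z' r s * _]mulrC -!mulrDl => /(mulIf nz).
rewrite -!addrA => /addrI /eqP.
by rewrite -!natrD eqr_nat addnC [RHS]addnC => /eqP.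
Qed.

Lemma grade_mx_euler :
  e^%:P *m grade_mx = a0%:P *: grade_mx + 'X *: map_mx (@deriv F) grade_mx.
Proof.
have -> : map_mx (@deriv F) grade_mx =
    (invmx P)^%:P *m diag_mx (\row_j ('X^(k j))^`()) *m P^%:P.
  rewrite /grade_mx; apply/matrixP => i j; rewrite !mxE raddf_sum; apply: eq_bigr => l _.
  by rewrite !mul_mx_diag !mxE /= !derivM !derivC mulr0 addr0 mul0r add0r.
pose D : 'M[{poly F}]_m := diag_mx (\row_j 'X^(k j)).
pose D' : 'M[{poly F}]_m := diag_mx (\row_j ('X^(k j))^`()).
transitivity ((invmx P)^%:P *m ((diag_mx (\row_j (a0 + (k j)%:R)))^%:P *m D) *m P^%:P).
  rewrite /grade_mx /e !map_mxM !mulmxA.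
  by rewrite -[_ *m P^%:P *m (invmx P)^%:P]mulmxA PPV mulmx1.
suff -> : (diag_mx (\row_j (a0 + (k j)%:R)))^%:P *m D = a0%:P *: D + 'X *: D'.
  by rewrite mulmxDr mulmxDl -!scalemxAr -!scalemxAl.
apply/matrixP => i j; rewrite /D /D' map_diag_mx mul_diag_mx !mxE.
case: eqP => [->|_]; rewrite ?mulr1n ?mulr0n ?mulr0 ?addr0 //.
rewrite derivXn rmorphD rmorph_nat mulrDl; congr (_ + _).
case: (k j) => [|l]; first by rewrite mul0r mulr0n mulr0.
by rewrite mulrnAr -exprS mulr_natl.
Qed.

Lemma grade_mx_eval x : map_mx (horner_eval x) grade_mx =
  invmx P *m diag_mx (\row_j x ^+ k j) *m P.
Proof.
rewrite /grade_mx !map_mxM map_diag_mx.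
have cK (M : 'M[F]_m) : map_mx (horner_eval x) M^%:P = M.
  by apply/matrixP => i j; rewrite !mxE /horner_eval hornerC.
rewrite !cK; congr (_ *m diag_mx _ *m _).
by apply/matrixP => i j; rewrite !mxE; exact: hornerXn.
Qed.

Lemma grade_mx0_idem (T0 := map_mx (horner_eval 0) grade_mx) : T0 *m T0 = T0.
Proof.
rewrite /T0 grade_mx_eval !mulmxA mulmxK //; congr (_ *m _).
rewrite -mulmxA; congr (_ *m _); apply/matrixP => i j; rewrite mul_diag_mx !mxE.
by case: (k i) => [|l]; rewrite ?expr0 ?mul1r // exprS !mul0r mul0rn.
Qed.

Lemma grade_mx0_neq0 : root (char_poly e) a0 -> map_mx (horner_eval 0) grade_mx != 0.
Proof.
move=> /char_poly_eigenvector[v v0 ev]; apply: contra_neq v0 => T0.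
rewrite -[v](mulKmx Pu); apply/eqP; rewrite -[0](mulmx0 _ (invmx P)); apply/eqP.
congr (_ *m _).
have dv : diag_mx (\row_j (a0 + (k j)%:R)) *m (P *m v) = a0 *: (P *m v).
  by rewrite scalemxAr -ev /e !mulmxA mulmxV // mul1mx.
have d0 : diag_mx (\row_j (0 : F) ^+ k j) *m (P *m v) = 0.
  rewrite mulmxA -[_ *m P](mulKVmx Pu) [invmx P *m _]mulmxA -grade_mx_eval T0.
  by rewrite mulmx0 mul0mx.
move: (P *m v) dv d0 => z dv d0; apply/matrixP => i j.
have /matrixP /(_ i j) := dv; have /matrixP /(_ i j) := d0.
rewrite !mul_diag_mx !mxE; case: (k i) => [|l]; first by rewrite expr0 mul1r.
move=> _ /eqP; rewrite -subr_eq0 -mulrBl addrAC subrr add0r mulf_eq0 pnatr_eq0.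
by move=> /eqP.
Qed.

End GradingOperator.

(** * Signed permutations and their reflections *)
Section SignedPerms.
Variable n : nat.

(** The elements of D_n are those of even parity. *)
Definition neg_parity (w : signed_perm n) : bool := \big[addb/false]_i sp_sign w i.

Lemma mem_Dn w : (w \in Dn n) = ~~ neg_parity w.
Proof. by rewrite inE odd_sign_changes. Qed.

Lemma neg_parityM u v : neg_parity (u * v)%g = neg_parity u (+) neg_parity v.
Proof.
rewrite /neg_parity (eq_bigr (fun i => sp_sign u i (+) sp_sign v (sp_perm u i))).
  by rewrite big_split /= [X in _ = _ (+) X](reindex_inj (@perm_inj _ (sp_perm u))).
by move=> i _; rewrite ffunE.
Qed.

Lemma neg_parityV w : neg_parity w^-1%g = neg_parity w.
Proof.
have := neg_parityM w w^-1%g; rewrite mulgV.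
have -> : neg_parity 1%g = false by apply: big1 => i _; rewrite ffunE.
by case: (neg_parity w); case: (neg_parity _).
Qed.

Lemma Dn_conj u w : (u ^ w)%g \in Dn n = (u \in Dn n).
Proof.
by rewrite !mem_Dn /conjg !neg_parityM neg_parityV addbCA addbb addbF.
Qed.

Section Matrices.
Variable F : numFieldType.
Local Notation rho := (@sp_mx n F).

Lemma sp_mxM u v : rho (u * v)%g = rho u *m rho v.
Proof. by have := (sp_mx_repr n F).2 u v; apply; rewrite inE. Qed.

Lemma sp_mx1 : rho 1%g = 1%:M.
Proof. exact: (sp_mx_repr n F).1. Qed.

Lemma sp_mxV u : rho u^-1%g *m rho u = 1%:M.
Proof. by rewrite -sp_mxM mulVg sp_mx1. Qed.

(** The diagonal entry of w at i is 1 - defect w i. *)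
Let defect (w : signed_perm n) i : nat :=
  if sp_perm w i == i then (if sp_sign w i then 2 else 0) else 1.

Let defectE w i : (rho w - 1%:M) i i = - (defect w i)%:R.
Proof.
rewrite sp_mxB1 eqxx /defect; case: eqP => _; last by rewrite mulr0 sub0r.
by case: (sp_sign w i); rewrite mulr1 ?expr1 ?expr0 ?subrr ?oppr0 // -opprD.
Qed.

Lemma sp_mx_tr_inj w : \tr (rho w - 1%:M) = 0 -> w = 1%g.
Proof.
move=> tr0; have D0 i : defect w i = 0%N.
  have : \sum_i (defect w i)%:R = 0 :> F.
    apply/eqP; rewrite -oppr_eq0 -sumrN -(eq_bigr _ (fun i _ => defectE w i)).
    by apply/eqP.
  move=> /eqP; rewrite -natr_sum pnatr_eq0 sum_nat_eq0 => /forallP /(_ i) /eqP.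
  by [].
apply: signed_perm_eq => [|i] /=.
  by apply/permP => i; rewrite perm1; have := D0 i; rewrite /defect; case: eqP.
by rewrite ffunE; have := D0 i; rewrite /defect; case: eqP; case: (sp_sign w i).
Qed.

Lemma sp_mx_inj w : rho w = 1%:M -> w = 1%g.
Proof. by move=> E; apply: sp_mx_tr_inj; rewrite E subrr linear0. Qed.

(** Let A = w - 1, of rank one. Then w A = (1 + tr A) A with tr A = -k for a natural
    number k, and finite order forces |1 - k| = 1; the case k = 0 is excluded because
    only the identity has zero defect. *)
Lemma reflection_tr w : is_reflection rho w -> \tr (rho w - 1%:M) = - 2.
Proof.
move=> /eqP rk; set A := rho w - 1%:M.
have trA : \tr A = - (\sum_i defect w i)%:R.
  by rewrite natr_sum -sumrN; apply: eq_bigr => i _; apply: defectE.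
move: (\sum_i defect w i)%N trA => k trA.
have A2 := rank1_sqr rk.
have wA : rho w *m A = (1 - k%:R) *: A.
  by rewrite -[rho w](subrK 1%:M) mulmxDl mul1mx A2 trA scalerDl scale1r addrC.
have wkA l : rho (w ^+ l)%g *m A = (1 - k%:R) ^+ l *: A.
  elim: l => [|l IH]; first by rewrite expg0 sp_mx1 mul1mx scale1r.
  by rewrite expgS sp_mxM -mulmxA IH -scalemxAr wA scalerA exprSr.
have A0 : A != 0 by rewrite -mxrank_eq0 rk.
have := wkA #[w]%g; rewrite expg_order sp_mx1 mul1mx => /eqP.
rewrite -[X in X == _]scale1r -subr_eq0 -scalerBl scaler_eq0 (negbTE A0) orbF.
rewrite subr_eq0 eq_sym => /eqP /(congr1 Num.norm); rewrite normrX normr1 => /eqP.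
rewrite pexpr_eq1 ?normr_ge0 // -?lt0n ?order_gt0 // distrC.
case: k trA {wA wkA} => [|k] trA.
  have w1 : w = 1%g by apply: sp_mx_tr_inj; rewrite -/A trA oppr0.
  by move: A0; rewrite /A w1 sp_mx1 subrr eqxx.
rewrite -addn1 natrD addrK normr_nat -[1]/(1%:R) eqr_nat => /eqP k1.
by rewrite trA k1.
Qed.

Lemma reflection_sqr w : is_reflection rho w -> (w * w = 1)%g.
Proof.
move=> rw; apply: sp_mx_inj; rewrite sp_mxM; have trA := reflection_tr rw.
move/eqP: rw => rk; have A2 : (rho w - 1%:M) *m (rho w - 1%:M) = - 2 *: (rho w - 1%:M).
  by rewrite -trA; apply: rank1_sqr.
rewrite -[rho w](subrK 1%:M) mulmxDl mul1mx mulmxDr mulmx1 A2 scaleNr scaler_nat mulr2n.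
by move: (rho w - 1%:M) => A; rewrite opprD addrNK addKr.
Qed.

(** A reflection s of a signed permutation group is an involution, hence acts by
    y - <alpha, y> alpha^vee whatever the choice of the pair of roots. *)
Lemma reflection_roots w x y : is_reflection rho w ->
  pairing (refl_root rho w) y * pairing x (refl_coroot rho w) =
  pairing x ((1%:M - rho w) *m y).
Proof.
move=> rw; have w2 := reflection_sqr rw; have trA := reflection_tr rw.
have wV : (w^-1 = w)%g by apply: (mulgI w); rewrite mulgV w2.
have two0 : (2 : F) != 0 by rewrite pnatr_eq0.
move/eqP: rw => rk; set A := rho w - 1%:M in trA rk.
have A2 : A *m A = - 2 *: A by rewrite -trA; apply: rank1_sqr.
have rhoE : rho w = A + 1%:M by rewrite subrK.
clearbody A.
have : is_root_pair rho w (root_pair rho w).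
  apply: (@xgetPex _ (0, 0) [set p | is_root_pair rho w p]%classic).
  (* If s - 1 = u v, then v and - u form such a pair, for the eigenvalue -1. *)
  have [u [v Auv]] : exists (u : 'cV_n) (v : 'rV_n), A = u *m v.
    rewrite -(mulmx_base A); move: (col_base A) (row_base A); rewrite rk => u v.
    by exists u, v.
  have vu : v *m u = (- 2)%:M.
    by rewrite [LHS]mx11_scalar -trA Auv mxtrace_mulC /mxtrace big_ord1.
  exists (v, - u), (-1); split => /=.
  - by rewrite -subr_eq0 -opprD oppr_eq0.
  - rewrite wV rhoE Auv mulmxDr mulmx1 mulmxA vu mul_scalar_mx -[in X in _ + X](scale1r v).
    by rewrite -scalerDl; congr (_ *: _); ring.
  - rewrite rhoE Auv mulmxDl mul1mx mulmxN -mulmxA vu mul_mx_scalar invrN1 scaleN1r.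
    by rewrite scaleNr opprK opprK scaler_nat mulr2n addrK.
  - by rewrite /pairing mulmxN vu !mxE eqxx mulr1n opprK.
rewrite /refl_root /refl_coroot; case: (root_pair rho w) => a b [l [l1]] /=.
rewrite wV rhoE /pairing.
rewrite [a *m _]mulmxDr mulmx1 [_ *m b]mulmxDl mul1mx => Ea Eb ab.
have aA : a *m A = (l - 1) *: a by rewrite scalerBl scale1r -Ea addrK.
have Ab : A *m b = (l^-1 - 1) *: b by rewrite scalerBl scale1r -Eb addrK.
have a0 : a != 0.
  by apply/eqP => a0; move: ab; rewrite a0 mul0mx mxE => /esym/eqP; rewrite (negbTE two0).
have lE : l = -1.
  have := congr1 (mulmx a) A2; rewrite -scalemxAr mulmxA !aA -scalemxAl aA !scalerA => /eqP.
  rewrite -subr_eq0 -scalerBl scaler_eq0 (negbTE a0) orbF -mulrBl mulf_eq0.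
  rewrite [X in _ || X]subr_eq0 (negbTE l1) orbF opprK => /eqP E.
  have E2 : l = (l - 1 + 2) - 1 by ring.
  by rewrite E2 E sub0r.
have aAb : (a *m A *m b) 0 0 = - 4 by rewrite aA lE -scalemxAl mxE ab; ring.
have := rank1_sandwich b a rk; rewrite aAb Ab aA lE invrN1 -scalemxAl -scalemxAr scalerA.
have -> : (-1 - 1) * (-1 - 1) = 4 :> F by ring.
move=> bA; have -> : 1%:M - (A + 1%:M) = b *m a.
  rewrite opprD addrCA subrr addr0; apply: (scalerI (a := 4)); first by rewrite pnatr_eq0.
  by rewrite bA scaleNr scalerN.
rewrite mulrC !mulmxA [x *m b]mx11_scalar -mulmxA mul_scalar_mx mxE.
by rewrite !mxE eqxx mulr1n.
Qed.

End Matrices.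
End SignedPerms.

Section DnReflections.
Variables (F : numFieldType) (n : nat).
Local Notation refl := (reflections (Dn_repr n F)).
Local Notation rho := (@sp_mx n F).

Lemma refl_Dn s : s \in refl -> s \in Dn n.
Proof. by rewrite !inE => /andP[]. Qed.

Lemma refl_is_reflection s : s \in refl -> is_reflection rho s.
Proof. by rewrite inE => /andP[]. Qed.

Lemma refl_inv s : s \in refl -> (s^-1 = s)%g.
Proof.
by move=> /refl_is_reflection /reflection_sqr s2; apply: (mulgI s); rewrite mulgV s2.
Qed.

Lemma refl_conj s w : ((s ^ w)%g \in refl) = (s \in refl).
Proof.
rewrite /reflections ![in LHS]inE ![in RHS]inE; congr (_ && _).
  by have := Dn_conj s w; rewrite !inE.
rewrite /is_reflection /=; congr (_ == _).
have -> : rho (s ^ w)%g - 1%:M = rho w^-1%g *m (rho s - 1%:M) *m rho w.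
  by rewrite mulmxBr mulmxBl mulmx1 sp_mxV /conjg !sp_mxM mulmxA.
have uw : rho w \in unitmx by apply: (mulmx1_unit (sp_mxV F w)).2.
have uwV : rho w^-1%g \in unitmx by apply: (mulmx1_unit (sp_mxV F w)).1.
rewrite mxrankMfree ?row_free_unit // -mxrank_tr trmx_mul.
by rewrite mxrankMfree ?mxrank_tr // row_free_unit unitmx_tr.
Qed.

End DnReflections.

(** * Cycles of signed permutations *)
Section OddCentralizer.
Variables (n : nat) (F : numFieldType).
Local Notation rho := (@sp_mx n F).

Definition sign_flip (i : 'I_n) : signed_perm n :=
  SignedPerm 1%g [ffun j => j == i].

Lemma sign_flip_sqr i : (sign_flip i * sign_flip i = 1)%g.
Proof.
apply: signed_perm_eq => [|j] /=; first by rewrite mulg1.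
by rewrite !ffunE perm1 addbb.
Qed.

Lemma sign_flip_parity i : neg_parity (sign_flip i).
Proof.
rewrite /neg_parity (bigD1 i) //= ffunE eqxx big1 // => j ji.
by rewrite ffunE (negbTE ji).
Qed.

Section Cycle.
Variables (w : signed_perm n) (i0 : 'I_n).
Let s := sp_perm w.
Let e := sp_sign w.
Let O := porbit s i0.

Lemma porbit_step i : (s i \in O) = (i \in O).
Proof.
rewrite -!eq_porbit_mem -[s i]/((s ^+ 1)%g i).
by rewrite porbit_perm.
Qed.

Definition cycle_fun i := if i \in O then s i else i.

Lemma cycle_fun_inj : injective cycle_fun.
Proof.
move=> i j; rewrite /cycle_fun; case: ifP => iO; case: ifP => jO.
- exact: perm_inj.
- by move=> E; rewrite -E porbit_step iO in jO.
- by move=> E; rewrite E porbit_step jO in iO.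
- by [].
Qed.

(** The cycle of w through i0, as a signed permutation fixing the other
    coordinates. *)
Definition cycle_part : signed_perm n :=
  SignedPerm (perm cycle_fun_inj) [ffun i => (i \in O) && e i].

Lemma cycle_part_comm : commute cycle_part w.
Proof.
apply: signed_perm_eq => [|i] /=.
  apply/permP => i; rewrite !permM !permE /cycle_fun -/s porbit_step.
  by case: ifP.
rewrite !ffunE permE /cycle_fun -/s porbit_step -/e; case: ifP => //= _.
by rewrite addbF.
Qed.

(** The sign accumulated along the first k steps of the cycle. *)
Let sgn k : bool := \big[addb/false]_(j < k) e (iter j s i0).

Lemma cycle_part_parity : neg_parity cycle_part = sgn #|O|.
Proof.
rewrite /neg_parity (eq_bigr (fun i => if i \in O then e i else false)); last first.
  by move=> i _; rewrite ffunE; case: (i \in O).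
rewrite -big_mkcond /=.
have -> : sgn #|O| = \big[addb/false]_(i <- traject s i0 #|O|) e i.
  rewrite (big_nth i0) size_traject big_mkord; apply: eq_bigr => j _.
  by rewrite nth_traject.
rewrite -big_enum /=; apply: perm_big; apply: uniq_perm.
- exact: enum_uniq.
- exact: uniq_traject_porbit.
- by move=> i; rewrite mem_enum porbit_traject.
Qed.

Lemma rho_delta i : rho w *m delta_mx (s i) 0 = (-1) ^+ e i *: delta_mx i 0 :> 'cV[F]_n.
Proof.
apply/matrixP => j k; rewrite ord1 sp_mx_act !mxE !eqxx !andbT -/s -/e.
rewrite (inj_eq perm_inj); case: eqP => [-> //|_]; by rewrite !mulr0.
Qed.

(** A positive cycle has a fixed vector, which is the sum of the basis vectors of the
    cycle with the accumulated signs as coefficients. *)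
Lemma positive_cycle_det : ~~ neg_parity cycle_part -> \det (1%:M - rho w) = 0.
Proof.
rewrite cycle_part_parity => even_l.
set l := #|O| in even_l *; pose z k : 'cV[F]_n := (-1) ^+ sgn k *: delta_mx (iter k s i0) 0.
have wz k : rho w *m z k.+1 = z k.
  rewrite /z -scalemxAr iterS rho_delta scalerA -signr_addb /sgn big_ord_recr /=.
  by rewrite -addbA addbb addbF.
have zl : z l = z 0%N.
  by rewrite /z (negbTE even_l) /sgn big_ord0 /= iter_porbit.
have lE : l = l.-1.+1 by rewrite prednK // lt0n card_porbit_neq0.
pose v := \sum_(k < l.-1.+1) z k.
have wv : rho w *m v = v.
  rewrite /v mulmx_sumr big_ord_recl [RHS]big_ord_recr /= -zl {1}lE wz addrC.
  by congr (_ + _); apply: eq_bigr => k _; rewrite wz.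
have v0 : v != 0.
  apply/eqP => /matrixP /(_ i0 0); rewrite /v summxE mxE big_ord_recl big1 ?addr0.
    by rewrite /z /sgn big_ord0 !mxE !eqxx /= mulr1 => /eqP; rewrite oner_eq0.
  move=> k _; have kl : (lift ord0 k < l)%N by rewrite [X in (_ < X)%N]lE ltn_ord.
  have k0 : (0%N == lift ord0 k) = false by [].
  move: (nat_of_ord (lift ord0 k)) kl k0 => {}k kl k0.
  have l0 : (0 < l)%N by rewrite lE.
  have := nth_uniq i0 (s := traject s i0 l) (i := 0%N) (j := k).
  rewrite size_traject kl l0 uniq_traject_porbit !nth_traject // k0.
  by move=> /(_ isT isT isT); rewrite /z !mxE /= => ->; rewrite mulr0.
apply/eqP; rewrite -det_tr; apply/det0P; exists v^T; first by rewrite trmx_eq0.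
by rewrite -trmx_mul mulmxBl mul1mx wv subrr trmx0.
Qed.

End Cycle.

(** Without fixed vector all cycles of w are negative; any one of them is odd and
    commutes with w. *)
Lemma odd_centralizer (w : signed_perm n) : (0 < n)%N ->
  \det (1%:M - rho w) != 0 -> exists2 b, b \notin Dn n & commute b w.
Proof.
move=> n0 Dw; exists (cycle_part w (Ordinal n0)); last exact: cycle_part_comm.
by rewrite mem_Dn negbK; apply: contraNT Dw => /positive_cycle_det ->.
Qed.

End OddCentralizer.

(** * Matrix actions of the algebra of type D and the Euler element *)

Section MatrixAlgebra.
Variables (F : fieldType) (m : nat).

Let scalar_mxD : {morph (@scalar_mx F m) : a b / a + b}.
Proof. exact: raddfD. Qed.
Let scalar_mx_central (a : F) (x : 'M[F]_m) : a%:M * x = x * a%:M.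
Proof. exact/esym/scalar_mxC. Qed.

HB.instance Definition _ := PzRing_isAssocAlg.Build F 'M[F]_m
  scalar_mxD (@scalar_mxM F m) erefl scalar_mx_central.
End MatrixAlgebra.

Definition mx_alg (F : fieldType) m : assocAlgType F := [the assocAlgType F of 'M[F]_m].

Section Action.
Variables (F : numClosedFieldType) (n m : nat) (c : F).
Variables (W : signed_perm n -> mx_alg F m) (X : 'rV[F]_n -> mx_alg F m)
  (Y : 'cV[F]_n -> mx_alg F m).
Hypothesis act : cherednik_map (Dn_repr n F) (fun=> c) W X Y.
Local Notation refl := (reflections (Dn_repr n F)).
Local Notation rho := (@sp_mx n F).

Lemma actW1 : W 1%g = 1%:M. Proof. exact: cmapW1 act. Qed.

Lemma actWM u v : u \in Dn n -> v \in Dn n -> W (u * v)%g = W u *m W v.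
Proof. exact: cmapWM act u v. Qed.

Lemma actX_lin a x x' : X (a *: x + x') = a *: X x + X x'.
Proof. by rewrite (cmapX_lin act) -mul_scalar_mx. Qed.

Lemma actY_lin a y y' : Y (a *: y + y') = a *: Y y + Y y'.
Proof. by rewrite (cmapY_lin act) -mul_scalar_mx. Qed.

Lemma actWX w x : w \in Dn n -> W w *m X x = X (x *m rho w^-1%g) *m W w.
Proof. exact: cmapWX act w x. Qed.

Lemma actWY w y : w \in Dn n -> W w *m Y y = Y (rho w *m y) *m W w.
Proof. exact: cmapWY act w y. Qed.

Lemma actYX y x : Y y *m X x = X x *m Y y + (pairing x y)%:M
  - c *: (\sum_(s in refl) pairing x ((1%:M - rho s) *m y) *: W s).
Proof.
have /eqP := cmapYX act y x; rewrite subr_eq => /eqP E.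
rewrite -[LHS]/(Y y * X x) {}E addrC addrA; congr (_ + _ - _).
rewrite scaler_sumr; apply: eq_bigr => s s_refl.
rewrite -mulrA reflection_roots ?refl_is_reflection // scalerA.
exact: mul_scalar_mx.
Qed.

Lemma actX_sum I (r : seq I) (P : pred I) (a : I -> F) x :
  X (\sum_(i <- r | P i) a i *: x i) = \sum_(i <- r | P i) a i *: X (x i).
Proof.
have X0 : X 0 = 0.
  by have := actX_lin (-1) 0 0; rewrite scaler0 addr0 scaleN1r addNr.
elim/big_rec2: _ => // i u v _ <-; exact: actX_lin.
Qed.

Lemma actY_sum I (r : seq I) (P : pred I) (a : I -> F) y :
  Y (\sum_(i <- r | P i) a i *: y i) = \sum_(i <- r | P i) a i *: Y (y i).
Proof.
have Y0 : Y 0 = 0.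
  by have := actY_lin (-1) 0 0; rewrite scaler0 addr0 scaleN1r addNr.
elim/big_rec2: _ => // i u v _ <-; exact: actY_lin.
Qed.

Lemma actXD x x' : X (x + x') = X x + X x'.
Proof. by have := actX_lin 1 x x'; rewrite !scale1r. Qed.

Lemma actYD y y' : Y (y + y') = Y y + Y y'.
Proof. by have := actY_lin 1 y y'; rewrite !scale1r. Qed.

Let dx i : 'rV[F]_n := delta_mx 0 i.
Let dy i : 'cV[F]_n := delta_mx i 0.

Lemma actX_coord x : X x = \sum_i x 0 i *: X (dx i).
Proof. by rewrite {1}(row_sum_delta x) actX_sum. Qed.

Lemma actY_coord y : Y y = \sum_i y i 0 *: Y (dy i).
Proof.
rewrite -actY_sum; congr Y; apply/matrixP => i j; rewrite ord1 summxE.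
rewrite (bigD1 i) //= big1 => [|k ki]; rewrite !mxE ?eqxx ?mulr1 ?addr0 //.
by rewrite eq_sym (negbTE ki) mulr0.
Qed.

Lemma pairing_dy x i : pairing x (dy i) = x 0 i.
Proof. by rewrite /pairing -colE mxE. Qed.

Lemma pairing_dx i y : pairing (dx i) y = y i 0.
Proof. by rewrite /pairing -rowE mxE. Qed.

Definition refl_sum : 'M[F]_m := \sum_(s in refl) W s.
(** The Euler element without its usual constant term. *)
Definition euler : 'M[F]_m := \sum_i X (dx i) *m Y (dy i) - c *: refl_sum.

(** The parameter is constant, and conjugation permutes the reflections. *)
Lemma refl_sum_comm w : w \in Dn n -> W w *m refl_sum = refl_sum *m W w.
Proof.
move=> wD; rewrite /refl_sum mulmx_sumr mulmx_suml.
rewrite [RHS](reindex_inj (conjg_inj w^-1%g)) /=.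
apply: eq_big => [s|s /refl_Dn sD]; first by rewrite refl_conj.
by rewrite -!actWM ?Dn_conj // /conjg invgK -!mulgA mulVg mulg1.
Qed.

Lemma eulerW w : w \in Dn n -> W w *m euler = euler *m W w.
Proof.
move=> wD; rewrite /euler mulmxBr mulmxBl -scalemxAr -scalemxAl refl_sum_comm //.
congr (_ - _); rewrite mulmx_sumr mulmx_suml.
transitivity (\sum_i X (dx i *m rho w^-1%g) *m Y (rho w *m dy i) *m W w).
  by apply: eq_bigr => i _; rewrite mulmxA actWX // -!mulmxA actWY.
rewrite -!mulmx_suml; congr (_ *m _).
transitivity (\sum_i \sum_j \sum_k (rho w^-1%g i j * rho w k i) *: (X (dx j) *m Y (dy k))).
  apply: eq_bigr => i _; rewrite actX_coord actY_coord mulmx_suml; apply: eq_bigr => j _.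
  rewrite mulmx_sumr; apply: eq_bigr => k _.
  by rewrite -scalemxAl -scalemxAr scalerA -rowE -colE !mxE.
rewrite exchange_big /=; apply: eq_bigr => j _; rewrite exchange_big /=.
have ww : rho w *m rho w^-1%g = 1%:M by rewrite -sp_mxM mulgV sp_mx1.
rewrite (bigD1 j) //= [X in _ + X]big1 ?addr0 => [|k kj].
  rewrite -scaler_suml; have -> : \sum_i rho w^-1%g i j * rho w j i = 1.
    have := congr1 (fun M : 'M_n => M j j) ww.
    rewrite [X in X = _]mxE [X in _ = X]mxE eqxx mulr1n => <-.
    by apply: eq_bigr => i _; rewrite mulrC.
  by rewrite scale1r.
rewrite -scaler_suml; have -> : \sum_i rho w^-1%g i j * rho w k i = 0.
  have := congr1 (fun M : 'M_n => M k j) ww.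
  rewrite [X in X = _]mxE [X in _ = X]mxE (negbTE kj) mulr0n => E0; rewrite -[RHS]E0.
  by apply: eq_bigr => i _; rewrite mulrC.
by rewrite scale0r.
Qed.

(** Commuting x with sum_i x_i y_i gives x - c sum_s (x - x s) s, and commuting x with
    the sum of the reflections gives the sum of the (x s - x) s. *)
Lemma eulerX x : euler *m X x = X x *m euler + X x.
Proof.
rewrite /euler mulmxBl mulmxBr -scalemxAr -scalemxAl.
have -> : (\sum_i X (dx i) *m Y (dy i)) *m X x = X x *m (\sum_i X (dx i) *m Y (dy i))
   + X x - c *: \sum_(s in refl) X (x *m (1%:M - rho s)) *m W s.
  rewrite mulmx_suml mulmx_sumr.
  under eq_bigr => i _ do rewrite -mulmxA actYX mulmxBr mulmxDr.
  rewrite sumrB big_split /=; congr (_ + _ - _).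
  - by apply: eq_bigr => i _; rewrite !mulmxA; congr (_ *m _); exact: cmapXX act _ _.
  - rewrite [RHS]actX_coord; apply: eq_bigr => i _.
    by rewrite mul_mx_scalar pairing_dy.
  under eq_bigr => i _ do rewrite -scalemxAr mulmx_sumr.
  rewrite -scaler_sumr exchange_big /=; congr (_ *: _); apply: eq_bigr => s _.
  rewrite actX_coord mulmx_suml; apply: eq_bigr => i _.
  by rewrite -scalemxAr -scalemxAl /pairing mulmxA -colE mxE.
have -> : refl_sum *m X x = \sum_(s in refl) X (x *m rho s) *m W s.
  rewrite mulmx_suml; apply: eq_bigr => s s_refl.
  by rewrite actWX ?(refl_Dn s_refl) // (refl_inv s_refl).
have -> : X x *m refl_sum = \sum_(s in refl) X (x *m (1%:M - rho s)) *m W s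
    + \sum_(s in refl) X (x *m rho s) *m W s.
  rewrite mulmx_sumr -big_split /=; apply: eq_bigr => s _.
  by rewrite -mulmxDl -actXD -mulmxDr subrK mulmx1.
by rewrite scalerDr opprD !addrA [RHS]addrAC; congr (_ + _); rewrite addrAC.
Qed.

Lemma eulerY y : Y y *m euler = euler *m Y y + Y y.
Proof.
rewrite /euler mulmxBl mulmxBr -scalemxAr -scalemxAl.
have -> : Y y *m (\sum_i X (dx i) *m Y (dy i)) = (\sum_i X (dx i) *m Y (dy i)) *m Y y
   + Y y - c *: \sum_(s in refl) W s *m Y ((1%:M - rho s) *m y).
  rewrite mulmx_suml mulmx_sumr.
  under eq_bigr => i _ do rewrite mulmxA actYX mulmxBl mulmxDl.
  rewrite sumrB big_split /=; congr (_ + _ - _).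
  - by apply: eq_bigr => i _; rewrite -!mulmxA; congr (_ *m _); exact: cmapYY act _ _.
  - rewrite [RHS]actY_coord; apply: eq_bigr => i _.
    by rewrite mul_scalar_mx pairing_dx.
  under eq_bigr => i _ do rewrite -scalemxAl mulmx_suml.
  rewrite -scaler_sumr exchange_big /=; congr (_ *: _); apply: eq_bigr => s _.
  rewrite actY_coord mulmx_sumr; apply: eq_bigr => i _.
  by rewrite -scalemxAr -scalemxAl pairing_dx.
have -> : Y y *m refl_sum = \sum_(s in refl) W s *m Y (rho s *m y).
  rewrite mulmx_sumr; apply: eq_bigr => s s_refl.
  rewrite actWY ?(refl_Dn s_refl) // mulmxA -sp_mxM.
  by rewrite (reflection_sqr (refl_is_reflection s_refl)) sp_mx1 mul1mx.
have -> : refl_sum *m Y y = \sum_(s in refl) W s *m Y ((1%:M - rho s) *m y)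
    + \sum_(s in refl) W s *m Y (rho s *m y).
  rewrite mulmx_suml -big_split /=; apply: eq_bigr => s _.
  by rewrite -mulmxDr -actYD -mulmxDl subrK mul1mx.
by rewrite scalerDr opprD !addrA [RHS]addrAC; congr (_ + _); rewrite addrAC.
Qed.

End Action.

(** * The grading of an irreducible module *)
Section Grading.
Variables (F : numClosedFieldType) (n m : nat) (c : F).
Variables (W : signed_perm n -> mx_alg F m) (X : 'rV[F]_n -> mx_alg F m)
  (Y : 'cV[F]_n -> mx_alg F m).
Hypothesis act : cherednik_map (Dn_repr n F) (fun=> c) W X Y.

(** Irreducibility tested on the generators of the algebra only. *)
Definition act_irreducible : Prop := (0 < m)%N /\
  forall P : 'cV[F]_m -> Prop, lin_pred P ->
    (forall w v, w \in Dn n -> P v -> P (W w *m v)) ->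
    (forall x v, P v -> P (X x *m v)) ->
    (forall y v, P v -> P (Y y *m v)) ->
    (exists2 v, v != 0 & P v) -> forall v, P v.

(** T plays the role of z^(eu - a0); its value at z = 0 is the projection to the lowest
    eigenspace of the Euler element. *)
Record grading_op (a0 : F) (T : 'M[{poly F}]_m) : Prop := GradingOp {
  grading_opX x : T *m (X x)^%:P = 'X *: ((X x)^%:P *m T);
  grading_opY y : (Y y)^%:P *m T = 'X *: (T *m (Y y)^%:P);
  grading_opW w : w \in Dn n -> (W w)^%:P *m T = T *m (W w)^%:P;
  grading_opE : (euler c W X Y)^%:P *m T = a0%:P *: T + 'X *: map_mx (@deriv F) T;
  grading_op_idem :
    map_mx (horner_eval 0) T *m map_mx (horner_eval 0) T = map_mx (horner_eval 0) T;
  grading_op_neq0 : map_mx (horner_eval 0) T != 0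
}.

(** Take an eigenvalue a0 such that a0 - 1 is not one. The span of the eigenspaces for
    a0, a0 + 1, ... is stable: x raises the eigenvalue by 1, and y lowers it by 1 and
    kills the eigenspace of a0. So it is the whole module. *)
Lemma grading_exists : act_irreducible -> exists a0 T, grading_op a0 T.
Proof.
move=> [m0 irr]; set e := euler c W X Y.
have [|a0 a0e a1e] := minimal_root (p := char_poly e).
  by rewrite size_char_poly ltnS.
pose S b := exists k, b = a0 + k%:R.
(* Q is the span of the eigenvectors with eigenvalue in a0 + nat. *)
pose Q v := forall P, lin_pred P -> (forall b v, S b -> e *m v = b *: v -> P v) -> P v.
have Q_lin : lin_pred Q.
  split=> [P [P0 _] _ //|a u v Qu Qv P P_lin PS].
  by case: (P_lin) => _; apply; [apply: Qu|apply: Qv].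
have Q_stable (Z : 'M[F]_m) : (forall b v, S b -> e *m v = b *: v -> Q (Z *m v)) ->
    forall v, Q v -> Q (Z *m v).
  move=> QZ v Qv; apply: (Qv (fun u => Q (Z *m u))) => //.
  case: Q_lin => Q0 QD; split=> [|a u u' Qu Qu']; first by rewrite mulmx0.
  by rewrite mulmxDr -scalemxAr; apply: QD.
have Qeig b v : S b -> e *m v = b *: v -> Q v by move=> Sb ev P _; apply; [exact: Sb|].
have Q_all : forall v, Q v.
  apply: irr => //.
  - move=> w v wD; apply: Q_stable => b u Sb eu; apply: (Qeig b) => //.
    by rewrite mulmxA -(eulerW act wD) -mulmxA eu scalemxAr.
  - move=> x v; apply: Q_stable => b u [k ->] eu; apply: (Qeig (a0 + k.+1%:R)).
      by exists k.+1.
    rewrite mulmxA (eulerX act) mulmxDl -mulmxA eu -scalemxAr -natr1 addrA.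
    by rewrite [RHS]scalerDl scale1r.
  - move=> y v; apply: Q_stable => b u [k ->] eu.
    have eYu : e *m (Y y *m u) = (a0 + k%:R - 1) *: (Y y *m u).
      rewrite scalerBl scale1r scalemxAr -eu [in RHS]mulmxA (eulerY act).
      by rewrite [(_ *m Y y + _) *m u]mulmxDl addrK mulmxA.
    case: k eu eYu => [|k] eu eYu; last first.
      by apply: Qeig eYu; exists k; rewrite -natr1 addrA addrK.
    suff -> : Y y *m u = 0 by case: Q_lin.
    apply/eqP/negPn/negP => Yu0; move: a1e; rewrite addr0 in eYu.
    by move=> /negP; apply; apply/char_poly_eigenvector; exists (Y y *m u).
  - have /char_poly_eigenvector[v v0 ev] := a0e; exists v => //.
    by apply: (Qeig a0) => //; exists 0%N; rewrite addr0.
have [|P [d [Pu ed dS]]] := @diagonalize_spanned _ _ e S.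
  by move=> P P_lin PS v; apply: Q_all.
have {dS}[k dk] := choice dS.
have {}ed : e = invmx P *m diag_mx (\row_j (a0 + (k j)%:R)) *m P.
  by rewrite ed; congr (_ *m diag_mx _ *m _); apply/matrixP => i j; rewrite ord1 !mxE dk.
have shift Z (i j : nat) : e *m Z + i%:R *: Z = Z *m e + j%:R *: Z ->
    'X^i *: (grade_mx P k *m Z^%:P) = 'X^j *: (Z^%:P *m grade_mx P k).
  by rewrite ed; apply: grade_mx_shift.
exists a0, (grade_mx P k); split.
- move=> x; have := @shift (X x) 0 1; rewrite !scale0r addr0 scale1r expr0 expr1 scale1r.
  by apply; apply: eulerX.
- move=> y; have := @shift (Y y) 1 0; rewrite !scale0r addr0 expr0 expr1 !scale1r => -> //.
  by apply/esym/eulerY.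
- move=> w wD; have := @shift (W w) 0 0; rewrite !scale0r !addr0 expr0 !scale1r => -> //.
  by apply/esym/eulerW.
- by rewrite -/e ed; apply: grade_mx_euler.
- exact: grade_mx0_idem.
- by apply: (@grade_mx0_neq0 _ _ _ _ a0) => //; rewrite -ed.
Qed.

End Grading.

(** * The differential equation of the graded traces *)
Section TraceEquation.
Variables (F : numClosedFieldType) (n m : nat) (c : F).
Variables (W : signed_perm n -> mx_alg F m) (X : 'rV[F]_n -> mx_alg F m)
  (Y : 'cV[F]_n -> mx_alg F m).
Hypothesis act : cherednik_map (Dn_repr n F) (fun=> c) W X Y.
Variables (a0 : F) (T : 'M[{poly F}]_m).
Hypothesis grT : grading_op c W X Y a0 T.
Local Notation refl := (reflections (Dn_repr n F)).
Local Notation rho := (@sp_mx n F).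
Local Notation dx i := (delta_mx 0 i : 'rV[F]_n).
Local Notation dy i := (delta_mx i 0 : 'cV[F]_n).

Definition graded_trace (w : signed_perm n) : {poly F} := \tr ((W w)^%:P *m T).
(** The denominator of the graded trace of w on a standard module. *)
Definition char_det (w : signed_perm n) : {poly F} :=
  \det (1%:M - 'X *: (rho w^-1%g)^%:P).
(** In the category O this would be the combination of the characters of the lowest
    weights of the standard modules into which V decomposes in the Grothendieck group,
    each with its power of z. *)
Definition normalized_trace w := graded_trace w * char_det w.

Lemma deriv_char_mx (B : 'M[F]_n) :
  map_mx (@deriv F) (1%:M - 'X *: B^%:P) = - B^%:P.
Proof.
apply/matrixP => i j; rewrite !mxE derivB derivM derivX derivC mul1r mulr0 addr0.
by case: (i == j); rewrite ?mulr1n ?mulr0n -?polyC1 derivC sub0r.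
Qed.

Lemma char_det_neq0 w : char_det w != 0.
Proof.
apply/eqP => /(congr1 (horner_eval 0)); rewrite /char_det -det_map_mx rmorph0.
have -> : map_mx (horner_eval 0) (1%:M - 'X *: (rho w^-1%g)^%:P) = 1%:M.
  by rewrite map_mxB map_mx1 map_mxZ [X in X *: _]hornerX scale0r subr0.
by rewrite det1 => /eqP; rewrite oner_eq0.
Qed.

(** 1 - s has rank one, so the update formula applies to 1 - z w^-1 s; its determinant
    is that of 1 - z s w^-1, by conjugation with s. *)
Lemma char_det_refl w s : s \in refl ->
  char_det (w * s)%g = char_det w +
    \tr (\adj (1%:M - 'X *: (rho w^-1%g)^%:P) *m
           ('X *: ((rho w^-1%g)^%:P *m (1%:M - rho s)^%:P))).
Proof.
move=> s_refl; set M := 1%:M - _.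
have [u [v uv]] : exists (u : 'cV[F]_n) (v : 'rV[F]_n), 1%:M - rho s = u *m v.
  have /eqP rk := refl_is_reflection s_refl.
  have {}rk : \rank (1%:M - rho s) = 1%N by rewrite -opprB mxrank_opp.
  rewrite -(mulmx_base (1%:M - rho s)).
  move: (col_base (1%:M - rho s)) (row_base (1%:M - rho s)); rewrite rk => u v.
  by exists u, v.
have N_rank1 : 'X *: ((rho w^-1%g)^%:P *m (1%:M - rho s)^%:P) =
    ('X *: ((rho w^-1%g)^%:P *m u^%:P)) *m v^%:P.
  by rewrite uv map_mxM mulmxA scalemxAl.
rewrite N_rank1 -det_add_rank1; last exact: char_det_neq0.
rewrite -N_rank1 /M map_mxB map_mx1 mulmxBr mulmx1 scalerBr addrA addrNK.
have ss : (rho s)^%:P *m (rho s)^%:P = 1%:M.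
  rewrite -map_mxM -sp_mxM (reflection_sqr (refl_is_reflection s_refl)) sp_mx1.
  by rewrite map_mx1.
rewrite /char_det invMg (refl_inv s_refl) sp_mxM map_mxM.
have -> : 1%:M - 'X *: ((rho s)^%:P *m (rho w^-1%g)^%:P) =
    (rho s)^%:P *m (1%:M - 'X *: ((rho w^-1%g)^%:P *m (rho s)^%:P)) *m (rho s)^%:P.
  rewrite mulmxBr mulmxBl mulmx1 ss -scalemxAr -scalemxAl; congr (_ - _ *: _).
  by rewrite -!mulmxA ss mulmx1.
by rewrite !det_mulmx mulrAC -det_mulmx ss det1 mul1r.
Qed.

Section Fixed.
Variable w : signed_perm n.
Hypothesis wD : w \in Dn n.
Let B := (rho w^-1%g)^%:P.
Let g := graded_trace.
(** The traces of w x_i y_j z^(eu - a0). *)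
Let Pm : 'M[{poly F}]_n :=
  \matrix_(i, j) \tr ((W w)^%:P *m (X (dx i))^%:P *m (Y (dy j))^%:P *m T).
(** The traces of w [y_j, x_k] z^(eu - a0), in row k and column j. *)
Let Q : 'M[{poly F}]_n :=
  (g w)%:M - c%:P *: \sum_(s in refl) g (w * s)%g *: (1%:M - rho s)^%:P.

Let trace_YX k j :
  \tr ((W w)^%:P *m (Y (dy j))^%:P *m (X (dx k))^%:P *m T) = Pm k j + Q k j.
Proof.
rewrite -!mulmxA [(Y _)^%:P *m (_ *m T)]mulmxA -map_mxM (actYX act).
rewrite map_mxB map_mxD mulmxBl mulmxDl mulmxBr mulmxDr linearB /= mxtraceD.
rewrite -addrA; congr (_ + _); first by rewrite !mxE map_mxM !mulmxA.
rewrite map_scalar_mx mul_scalar_mx -scalemxAr mxtraceZ -/(graded_trace w).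
rewrite map_mxZ map_polyC_sum /Q [RHS]mxE; congr (_ + _).
  by rewrite pairing_dx !mxE; case: eqP => _; rewrite ?mul1r ?mul0r.
rewrite [RHS]mxE; congr (- _); rewrite [RHS]mxE summxE -scalemxAl -scalemxAr.
rewrite mxtraceZ; congr (_ * _).
rewrite mulmx_suml mulmx_sumr mxtrace_sum; apply: eq_bigr => s s_refl.
rewrite map_mxZ -scalemxAl -scalemxAr mulmxA -map_mxM -(actWM act) ?(refl_Dn s_refl) //.
by rewrite mxtraceZ pairing_dx -colE !mxE mulrC.
Qed.

(** Moving x_i to the left of w, around the trace, and back through z^(eu - a0), costs
    a factor z w^-1 and a commutator. *)
Let trace_fixpoint : Pm = 'X *: (B *m (Pm + Q)).
Proof.
apply/matrixP => i j; rewrite !mxE.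
transitivity (\sum_k B i k * \tr ((X (dx k))^%:P *m ((W w)^%:P *m (Y (dy j))^%:P *m T))).
  rewrite -[(W w)^%:P *m _]map_mxM (actWX act) // (actX_coord act) mulmx_suml.
  rewrite map_polyC_sum !mulmx_suml mxtrace_sum; apply: eq_bigr => k _.
  rewrite -scalemxAl map_mxZ -!scalemxAl mxtraceZ map_mxM !mulmxA.
  by rewrite -rowE !mxE.
rewrite mulr_sumr; apply: eq_bigr => k _; rewrite mulrCA; congr (_ * _).
rewrite mxE -trace_YX mxtrace_mulC -!mulmxA (grading_opX grT).
by rewrite -!scalemxAr mxtraceZ !mulmxA.
Qed.

Let trace_euler : \tr Pm =
  a0%:P * g w + 'X * (g w)^`() + c%:P * \sum_(s in refl) g (w * s)%g.
Proof.
have -> : \tr Pm = \tr ((W w)^%:P *m (\sum_i X (dx i) *m Y (dy i))^%:P *m T).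
  rewrite map_polyC_sum mulmx_sumr mulmx_suml mxtrace_sum; apply: eq_bigr => i _.
  by rewrite mxE map_mxM !mulmxA.
have -> : \sum_i X (dx i) *m Y (dy i) = euler c W X Y + c *: refl_sum W.
  by rewrite /euler subrK.
rewrite map_mxD mulmxDr mulmxDl mxtraceD; congr (_ + _).
  rewrite -mulmxA (grading_opE grT) mulmxDr -!scalemxAr mxtraceD !mxtraceZ.
  congr (_ + _ * _); rewrite /g /graded_trace /mxtrace raddf_sum; apply: eq_bigr => i _.
  rewrite !mxE raddf_sum; apply: eq_bigr => j _.
  by rewrite !mxE /= derivM derivC mul0r add0r.
rewrite map_mxZ -scalemxAr -scalemxAl mxtraceZ /refl_sum map_polyC_sum.
congr (_ * _); rewrite mulmx_sumr mulmx_suml mxtrace_sum; apply: eq_bigr => s s_refl.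
by rewrite -map_mxM -(actWM act) ?(refl_Dn s_refl).
Qed.

(** Solving the fixed point equation for the matrix of traces with the adjugate of
    1 - z w^-1 gives D_w tr(Pm), where tr(Pm) involves the derivative of g_w; Jacobi's
    formula recognizes D_w' on the right, and [char_det_refl] the D_(ws). *)
Lemma normalized_trace_ode : 'X * (normalized_trace w)^`() =
  - (a0%:P * normalized_trace w)
  - c%:P * \sum_(s in refl) normalized_trace (w * s)%g.
Proof.
set M := 1%:M - 'X *: B.
have MP : M *m Pm = 'X *: (B *m Q).
  rewrite mulmxBl mul1mx {1}trace_fixpoint mulmxDr scalerDr -scalemxAl.
  by rewrite addrC addKr.
have DP : char_det w * \tr Pm = \tr (\adj M *m ('X *: (B *m Q))).
  by rewrite -MP mulmxA mul_adj_mx mul_scalar_mx mxtraceZ.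
have dD : 'X * (char_det w)^`() = - \tr (\adj M *m ('X *: B)).
  rewrite /char_det deriv_det deriv_char_mx -/M -/B mulmxN raddfN mulrN -mxtraceZ.
  by rewrite scalemxAr.
have trQ : \tr (\adj M *m ('X *: (B *m Q))) = - (g w * ('X * (char_det w)^`()))
   - c%:P * \sum_(s in refl) g (w * s)%g * (char_det (w * s)%g - char_det w).
  rewrite dD mulrN opprK /Q mulmxBr mul_mx_scalar scalerBr mulmxBr linearB /=.
  congr (_ - _); first by rewrite scalerA mulrC -scalerA -scalemxAr mxtraceZ.
  rewrite -[B *m _]scalemxAr scalerA mulrC -scalerA -scalemxAr mxtraceZ; congr (_ * _).
  rewrite mulmx_sumr scaler_sumr mulmx_sumr mxtrace_sum; apply: eq_bigr => s s_refl.
  rewrite -[B *m _]scalemxAr scalerA mulrC -scalerA -scalemxAr mxtraceZ; congr (_ * _).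
  by rewrite char_det_refl // [RHS]addrC addKr.
move: DP; rewrite trQ trace_euler => E.
rewrite /normalized_trace derivM mulrDr -!/(g _).
have -> : \sum_(s in refl) g (w * s)%g * char_det (w * s)%g =
   \sum_(s in refl) g (w * s)%g * (char_det (w * s)%g - char_det w) +
   char_det w * \sum_(s in refl) g (w * s)%g.
  rewrite mulr_sumr -big_split /=; apply: eq_bigr => s _.
  by rewrite mulrBr [char_det w * _]mulrC subrK.
move: E; move: (\sum_(s in refl) _ * (_ - _)) (\sum_(s in refl) _) => S1 S2 E.
apply/eqP; rewrite -subr_eq0; apply/eqP.
move/eqP: E; rewrite -subr_eq0 => /eqP <-; ring.
Qed.

End Fixed.
End TraceEquation.

(** * Traces on the lowest weight space *)
Section FormalCharacters.
Variables (F : numClosedFieldType) (n m : nat) (c : F).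
Variables (W : signed_perm n -> mx_alg F m) (X : 'rV[F]_n -> mx_alg F m)
  (Y : 'cV[F]_n -> mx_alg F m).
Hypothesis act : cherednik_map (Dn_repr n F) (fun=> c) W X Y.
Variables (a0 : F) (T : 'M[{poly F}]_m).
Hypothesis grT : grading_op c W X Y a0 T.
Variable t : signed_perm n.
Hypothesis t_odd : t \notin Dn n.
Hypothesis n_gt0 : (0 < n)%N.
Local Notation refl := (reflections (Dn_repr n F)).
Local Notation rho := (@sp_mx n F).

Definition lowest_proj : 'M[F]_m := map_mx (horner_eval 0) T.
Local Notation pi := lowest_proj.
Definition lowest_char w : F := \tr (W w *m pi).
Local Notation chi := lowest_char.

Let eval_polyC x p q (M : 'M[F]_(p, q)) : map_mx (horner_eval x) M^%:P = M.
Proof. by apply/matrixP => i j; rewrite !mxE /horner_eval hornerC. Qed.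

Lemma lowest_projX x : pi *m X x = 0.
Proof.
have := congr1 (map_mx (horner_eval 0)) (grading_opX grT x).
by rewrite map_mxZ !map_mxM eval_polyC [X in X *: _]hornerX scale0r.
Qed.

Lemma lowest_projY y : Y y *m pi = 0.
Proof.
have := congr1 (map_mx (horner_eval 0)) (grading_opY grT y).
by rewrite map_mxZ !map_mxM eval_polyC [X in X *: _]hornerX scale0r.
Qed.

Lemma lowest_projW w : w \in Dn n -> W w *m pi = pi *m W w.
Proof.
move=> wD; have := congr1 (map_mx (horner_eval 0)) (grading_opW grT wD).
by rewrite !map_mxM eval_polyC.
Qed.

(** On the lowest eigenspace the Euler element reduces to minus c times the sum of the
    reflections. *)
Lemma lowest_proj_refl_sum : c *: (refl_sum W *m pi) = - a0 *: pi.
Proof.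
have := congr1 (map_mx (horner_eval 0)) (grading_opE grT).
rewrite [RHS]map_mxD !map_mxZ !map_mxM eval_polyC [X in _ + X *: _]hornerX scale0r addr0.
rewrite [X in X *: _]hornerC -/pi /euler mulmxBl mulmx_suml big1 => [|i _]; last first.
  by rewrite -mulmxA lowest_projY mulmx0.
by rewrite sub0r -scalemxAl scaleNr => <-; rewrite opprK.
Qed.

Lemma graded_trace0 w : (graded_trace W T w).[0] = chi w.
Proof.
rewrite /graded_trace -[LHS]/(horner_eval 0 _) -trace_map_mx map_mxM eval_polyC.
by [].
Qed.

Lemma char_det_eval x w : (char_det F w).[x] = \det (1%:M - x *: rho w^-1%g).
Proof.
rewrite -[LHS]/(horner_eval x _) -det_map_mx map_mxB map_mx1 map_mxZ eval_polyC.
by rewrite [X in _ - X *: _]hornerX.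
Qed.

Lemma lowest_charJ u v : u \in Dn n -> v \in Dn n -> chi (u ^ v)%g = chi u.
Proof.
move=> uD vD; rewrite /chi /conjg !(actWM act) ?groupM ?groupV //.
rewrite -!mulmxA (lowest_projW vD) mxtrace_mulC -!mulmxA -(actWM act) ?groupV //.
by rewrite mulgV (actW1 act) mulmx1.
Qed.

Lemma lowest_char_conv u : u \in Dn n ->
  c * (\sum_(s in refl) chi (s * u)%g) = - a0 * chi u.
Proof.
move=> uD; rewrite /chi -mxtraceZ scalemxAr scaleNr -scaleN1r scalerA mulN1r.
rewrite -lowest_proj_refl_sum -scalemxAr mxtraceZ mulmxA (refl_sum_comm act) //.
rewrite /refl_sum !mulmx_suml mxtrace_sum; congr (_ * _).
by apply: eq_bigr => s s_refl; rewrite (actWM act) ?(refl_Dn s_refl).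
Qed.

(** It vanishes identically if V0 and its twist by t have the same character. *)
Definition twist_defect w : F := chi w^-1%g - chi (w^-1 ^ t)%g.
Local Notation f := twist_defect.

(** An odd element b commuting with w makes conjugation by t the same on w as
    conjugation by b t, an element of D_n. *)
Lemma twist_defect_eq0 w : w \in Dn n -> \det (1%:M - rho w^-1%g) != 0 -> f w = 0.
Proof.
move=> wD /(odd_centralizer n_gt0)[b b_odd bw]; apply/eqP; rewrite subr_eq0.
have -> : (w^-1 ^ t)%g = (w^-1 ^ (b * t))%g.
  by rewrite conjgM; congr (_ ^ t)%g; apply/esym/conjg_fixP/commgP/commute_sym.
rewrite lowest_charJ ?groupV // mem_Dn neg_parityM.
by move: b_odd t_odd; rewrite !mem_Dn !negbK => -> ->.
Qed.

Lemma twist_defect_conv w : w \in Dn n ->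
  c * (\sum_(s in refl) f (w * s)%g) = - a0 * f w.
Proof.
move=> wD; rewrite /f sumrB !mulrBr -!lowest_char_conv ?Dn_conj ?groupV //.
congr (_ * _ - _ * _).
  by apply: eq_bigr => s s_refl; rewrite invMg (refl_inv s_refl).
rewrite [RHS](reindex_inj (conjg_inj t)) /=; apply: eq_big => [s|s s_refl].
  by rewrite refl_conj.
by rewrite invMg (refl_inv s_refl) conjMg.
Qed.

(** H below is constant by the differential equation, and both sides of H(1) = H(0)
    are known. *)
Lemma twist_defect_orthogonal : \sum_(w in Dn n) f w * chi w = 0.
Proof.
pose N := normalized_trace W T; pose H := \sum_(w in Dn n) (f w)%:P * N w.
have swap : \sum_(w in Dn n) (f w)%:P * (c%:P * \sum_(s in refl) N (w * s)%g) =
    \sum_(w in Dn n) (c * \sum_(s in refl) f (w * s)%g)%:P * N w.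
  transitivity (\sum_(w in Dn n) \sum_(s in refl) c%:P * ((f w)%:P * N (w * s)%g)).
    by apply: eq_bigr => w _; rewrite mulrCA !mulr_sumr.
  transitivity (\sum_(w in Dn n) \sum_(s in refl) c%:P * ((f (w * s)%g)%:P * N w)).
    rewrite exchange_big [RHS]exchange_big /=; apply: eq_bigr => s s_refl.
    rewrite (reindex_inj (mulIg s)); apply: eq_big => [w|w _].
      exact: groupMr (refl_Dn s_refl).
    by rewrite -mulgA (reflection_sqr (refl_is_reflection s_refl)) mulg1.
  apply: eq_bigr => w _; rewrite -mulr_sumr -mulr_suml -rmorph_sum mulrA.
  by rewrite -rmorphM.
have XH : 'X * H^`() = 0.
  rewrite /H raddf_sum mulr_sumr /=.
  transitivity (\sum_(w in Dn n) ((- a0 * f w)%:P * N w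
      - (f w)%:P * (c%:P * \sum_(s in refl) N (w * s)%g))).
    apply: eq_bigr => w wD; rewrite derivM derivC mul0r add0r mulrCA.
    rewrite (normalized_trace_ode act grT wD) mulrBr -/N; congr (_ - _).
    by rewrite mulNr polyCN polyCM; ring.
  rewrite sumrB swap; apply/eqP; rewrite subr_eq0; apply/eqP.
  by apply: eq_bigr => w wD; rewrite twist_defect_conv.
have dH : H^`() = 0 by move/eqP: XH; rewrite mulf_eq0 polyX_eq0 => /eqP.
have := deriv0_const dH; rewrite /H !horner_sum big1 => [|w wD]; last first.
  rewrite hornerM hornerC /N /normalized_trace hornerM char_det_eval scale1r.
  have [->|/(twist_defect_eq0 wD)->] := eqVneq (\det (1%:M - rho w^-1%g)) 0.
    by rewrite !mulr0.
  by rewrite mul0r.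
move=> /esym H0; rewrite -[RHS]H0; apply: eq_bigr => w wD.
rewrite hornerM hornerC /N /normalized_trace hornerM char_det_eval graded_trace0.
by rewrite scale0r subr0 det1 mulr1.
Qed.

End FormalCharacters.

(** * Intertwiners by averaging over a finite group *)
Section TwistedIntertwiner.
Variables (F : numClosedFieldType) (gT : finGroupType) (G : {group gT}) (m : nat).
Variables (W : gT -> 'M[F]_m) (sigma : gT -> gT) (pi : 'M[F]_m).
Hypothesis WM : {in G &, forall u v, W (u * v)%g = W u *m W v}.
Hypothesis sigmaG : {in G, forall u, sigma u \in G}.
Hypothesis sigmaM : {in G &, {morph sigma : u v / (u * v)%g}}.
Hypothesis pi_idem : pi *m pi = pi.
Hypothesis piW : {in G, forall u, W u *m pi = pi *m W u}.

(** The projection, up to the factor |G|, of the endomorphisms of the image of pi onto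
    the intertwiners from the representation twisted by sigma to the representation. *)
Definition twisted_average (A : 'M[F]_m) : 'M[F]_m :=
  \sum_(w in G) W w *m pi *m A *m (pi *m W (sigma w^-1%g)).

Fact twisted_average_is_linear : linear twisted_average.
Proof.
move=> a A B; rewrite /twisted_average scaler_sumr -big_split /=.
apply: eq_bigr => w _.
by rewrite mulmxDr mulmxDl -scalemxAr -scalemxAl.
Qed.
HB.instance Definition _ := GRing.isLinear.Build F 'M[F]_m 'M[F]_m _
  twisted_average twisted_average_is_linear.

Lemma trace_twisted_average : \tr (lin_mx twisted_average) =
  \sum_(w in G) \tr (W w *m pi) * \tr (W (sigma w^-1%g) *m pi).
Proof.
rewrite mxtrace_lin_mx.
under eq_bigr => i _ do under eq_bigr => j _ do rewrite summxE.
under eq_bigr => i _ do rewrite exchange_big /=.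
rewrite exchange_big /=; apply: eq_bigr => w wG.
rewrite [W (sigma _) *m pi]piW ?sigmaG ?groupV // mulr_suml; apply: eq_bigr => i _.
rewrite mulr_sumr; apply: eq_bigr => j _.
rewrite -(mul_delta_mx (0 : 'I_1)) [W w *m pi *m (_ *m _)]mulmxA -colE -mulmxA -rowE.
by rewrite mxE big_ord1 !mxE.
Qed.

Lemma twisted_average_intertwines A v : v \in G ->
  W v *m twisted_average A = twisted_average A *m W (sigma v).
Proof.
move=> vG; rewrite /twisted_average mulmx_sumr mulmx_suml.
rewrite [RHS](reindex_inj (mulgI v)) /=; apply: eq_big => [w|w wG].
  by rewrite groupMl.
have swG : sigma w^-1%g \in G by rewrite sigmaG ?groupV.
rewrite (WM vG wG) -!mulmxA; do 5!congr (_ *m _).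
by rewrite -WM ?sigmaG ?groupV ?groupM // -sigmaM ?groupV ?groupM // invMg mulgKV.
Qed.

Lemma twisted_average_projl A : pi *m twisted_average A = twisted_average A.
Proof.
rewrite /twisted_average mulmx_sumr; apply: eq_bigr => w wG.
by rewrite !mulmxA -piW // -[W w *m pi *m pi]mulmxA pi_idem.
Qed.

Lemma twisted_average_projr A : twisted_average A *m pi = twisted_average A.
Proof.
rewrite /twisted_average mulmx_suml; apply: eq_bigr => w wG.
rewrite -!mulmxA piW ?sigmaG ?groupV //.
by rewrite [pi *m (pi *m _)]mulmxA pi_idem.
Qed.

End TwistedIntertwiner.

(** For sigma = id the average is |G| times an idempotent, so a zero trace would make
    it zero in characteristic 0; but it fixes pi up to |G|. *)
Lemma trace_average_neq0 (F : numClosedFieldType) (gT : finGroupType) (G : {group gT})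
    m (W : gT -> 'M[F]_m) (pi : 'M[F]_m) :
  W 1%g = 1%:M -> {in G &, forall u v, W (u * v)%g = W u *m W v} ->
  pi *m pi = pi -> {in G, forall u, W u *m pi = pi *m W u} -> pi != 0 ->
  \sum_(w in G) \tr (W w *m pi) * \tr (W w^-1%g *m pi) != 0.
Proof.
move=> W1 WM pi_idem piW pi0; set S := \sum_(w in G) _.
have -> : S = \tr (lin_mx (twisted_average G W id pi)).
  by rewrite (trace_twisted_average (sigma := id)).
set Th := twisted_average _ _ _ _; pose a : F := #|G|%:R.
have a0 : a != 0 by rewrite pnatr_eq0 -lt0n cardG_gt0.
have fixed A : (forall w, w \in G -> W w *m A = A *m W w) -> pi *m A *m pi = A ->
    Th A = a *: A.
  move=> WA piA; rewrite /Th /twisted_average /a -sumr_const scaler_suml.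
  apply: eq_bigr => w wG; rewrite scale1r -[W w *m pi *m A]mulmxA !mulmxA.
  rewrite -2![W w *m _ *m _]mulmxA piA WA // -mulmxA -WM ?groupV //.
  by rewrite mulgV W1 mulmx1.
have Th2 A : Th (Th A) = a *: Th A.
  apply: fixed => [w wG|]; first exact: twisted_average_intertwines.
  by rewrite twisted_average_projl // twisted_average_projr.
pose E := a^-1 *: lin_mx Th.
have EE : E *m E = E.
  rewrite /E -scalemxAl -scalemxAr; congr (_ *: _); apply/row_matrixP => i.
  rewrite !rowE scalemxAr mulmxA -[delta_mx 0 i]vec_mxK -scalemxAr !mul_vec_lin /=.
  by rewrite [X in mxvec X]Th2 linearZ /= scalerA mulVf // scale1r.
apply/eqP => tr0; have := mxtrace_idempotent EE; rewrite /E mxtraceZ tr0 mulr0.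
move=> /esym/eqP; rewrite pnatr_eq0 mxrank_eq0 -/E => /eqP E0.
have : mxvec pi *m E = mxvec pi.
  rewrite /E -scalemxAr mul_vec_lin -linearZ /= [X in mxvec (_ *: X)]fixed //.
    by rewrite scalerA mulVf // scale1r.
  by rewrite !pi_idem.
rewrite E0 mulmx0 => /esym/eqP; rewrite mxvec_eq0 => pi00.
by rewrite pi00 in pi0.
Qed.

(** * An irreducible module and its twist are isomorphic *)
Section TwistIso.
Variables (F : numClosedFieldType) (n m : nat) (c : F).
Variables (W : signed_perm n -> mx_alg F m) (X : 'rV[F]_n -> mx_alg F m)
  (Y : 'cV[F]_n -> mx_alg F m).
Hypothesis act : cherednik_map (Dn_repr n F) (fun=> c) W X Y.
Hypothesis irr : act_irreducible W X Y.
Variable t : signed_perm n.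
Hypothesis t_odd : t \notin Dn n.
Hypothesis t_sqr : (t * t = 1)%g.
Hypothesis n_gt0 : (0 < n)%N.
Local Notation refl := (reflections (Dn_repr n F)).
Local Notation rho := (@sp_mx n F).

(** Were all twisted averages zero, the trace of averaging would be zero, that is
    sum_w chi(w) chi(t w^-1 t) = 0, and orthogonality of the defect to chi would then
    contradict [trace_average_neq0]. *)
Lemma lowest_intertwiner : exists pi phi : 'M[F]_m,
  [/\ pi != 0, pi *m pi = pi, forall x, pi *m X x = 0, forall y, Y y *m pi = 0 &
      forall w, w \in Dn n -> W w *m pi = pi *m W w] /\
  [/\ phi != 0, pi *m phi = phi, phi *m pi = phi &
      forall w, w \in Dn n -> phi *m W w = W (w ^ t)%g *m phi].
Proof.
have [a0 [T grT]] := grading_exists act irr.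
set pi := lowest_proj T; exists pi.
have pi0 : pi != 0 := grading_op_neq0 grT.
have pi_idem : pi *m pi = pi := grading_op_idem grT.
have piW : {in Dn n, forall w, W w *m pi = pi *m W w}.
  by move=> w; exact: (lowest_projW grT).
have WM : {in Dn n &, forall u v, W (u * v)%g = W u *m W v}.
  by move=> u v; exact: (actWM act).
have W1 : W 1%g = 1%:M := actW1 act.
have sD : {in Dn n, forall w, (w ^ t)%g \in Dn n} by move=> w; rewrite Dn_conj.
have sM : {in Dn n &, {morph (fun w => (w ^ t)%g) : u v / (u * v)%g}}.
  by move=> u v _ _; apply: conjMg.
pose av := twisted_average (Dn n) W (conjg^~ t) pi.
have [A avA] : exists A, av A != 0.
  apply: contrapT => av0.
  have tr0 : \tr (lin_mx av) = 0.
    rewrite mxtrace_lin_mx big1 // => i _; rewrite big1 // => j _.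
    rewrite -[LHS]/(av (delta_mx i j) i j).
    have [->|nz] := eqVneq (av (delta_mx i j)) 0; first by rewrite mxE.
    by case: av0; exists (delta_mx i j).
  rewrite trace_twisted_average // in tr0.
  have /eqP := trace_average_neq0 W1 WM pi_idem piW pi0; apply.
  rewrite -[LHS]subr0 -[X in _ - X]tr0 -sumrB.
  rewrite -[RHS](twist_defect_orthogonal act grT t_odd n_gt0).
  apply: eq_bigr => w wD; rewrite /twist_defect /lowest_char -/pi.
  by rewrite mulrBl ![_ * \tr (W w *m pi)]mulrC.
exists (av A); split; split=> //.
- by move=> x; exact: (lowest_projX grT).
- by move=> y; exact: (lowest_projY grT).
- exact: twisted_average_projl.
- exact: twisted_average_projr.
move=> w wD; rewrite [RHS](twisted_average_intertwines pi WM sD sM) ?Dn_conj //.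
by rewrite -conjgM t_sqr conjg1.
Qed.

Let twistK (x : 'rV[F]_n) : x *m rho t *m rho t = x.
Proof. by rewrite -mulmxA -sp_mxM t_sqr sp_mx1 mulmx1. Qed.
Let Ktwist (y : 'cV[F]_n) : rho t *m (rho t *m y) = y.
Proof. by rewrite mulmxA -sp_mxM t_sqr sp_mx1 mul1mx. Qed.
Let conjtK w : ((w ^ t) ^ t)%g = w.
Proof. by rewrite -conjgM t_sqr conjg1. Qed.

Section Relation.
Variables (pi phi : 'M[F]_m).
Hypothesis pi_neq0 : pi != 0.
Hypothesis pi_idem : pi *m pi = pi.
Hypothesis piX : forall x, pi *m X x = 0.
Hypothesis Ypi : forall y, Y y *m pi = 0.
Hypothesis piW : forall w, w \in Dn n -> W w *m pi = pi *m W w.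
Hypothesis phi_neq0 : phi != 0.
Hypothesis pi_phi : pi *m phi = phi.
Hypothesis phi_pi : phi *m pi = phi.
Hypothesis phiW : forall w, w \in Dn n -> phi *m W w = W (w ^ t)%g *m phi.

(** The submodule of V + V^t generated by the graph of phi. The rules for x suffice:
    stability under W and the elements y is a consequence. *)
Inductive twist_rel : 'cV[F]_m -> 'cV[F]_m -> Prop :=
| TwistBase u : pi *m u = u -> twist_rel u (phi *m u)
| TwistX x u v : twist_rel u v -> twist_rel (X x *m u) (X (x *m rho t) *m v)
| TwistLin a u v u' v' : twist_rel u v -> twist_rel u' v' ->
    twist_rel (a *: u + u') (a *: v + v').

Lemma twist_rel0 : twist_rel 0 0.
Proof. by have := @TwistBase 0; rewrite !mulmx0; apply. Qed.

Lemma twist_relZ a u v : twist_rel u v -> twist_rel (a *: u) (a *: v).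
Proof. by move=> uv; have := TwistLin a uv twist_rel0; rewrite !addr0. Qed.

Lemma twist_relD u v u' v' : twist_rel u v -> twist_rel u' v' ->
  twist_rel (u + u') (v + v').
Proof. by move=> uv uv'; have := TwistLin 1 uv uv'; rewrite !scale1r. Qed.

Lemma twist_rel_sum (I : finType) (P : pred I) (u v : I -> 'cV[F]_m) :
  (forall i, P i -> twist_rel (u i) (v i)) ->
  twist_rel (\sum_(i | P i) u i) (\sum_(i | P i) v i).
Proof.
move=> uv; elim/big_rec2: _ => [|i u' v' Pi uv']; first exact: twist_rel0.
by apply: twist_relD; first exact: uv.
Qed.

(** In the lowest degree the submodule is no larger than the graph of phi. *)
Lemma twist_rel_proj u v : twist_rel u v -> pi *m v = phi *m u.
Proof.
elim=> {u v} [u _|x u v _ _|a u v u' v' _ E _ E'].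
- by rewrite mulmxA pi_phi.
- by rewrite !mulmxA piX -phi_pi -[phi *m pi *m _]mulmxA piX mulmx0 !mul0mx.
- by rewrite !mulmxDr -!scalemxAr E E'.
Qed.

Lemma twist_relW w u v : w \in Dn n -> twist_rel u v ->
  twist_rel (W w *m u) (W (w ^ t)%g *m v).
Proof.
move=> wD; elim=> {u v} [u pu|x u v _ IH|a u v u' v' _ IH _ IH'].
- rewrite mulmxA -phiW // -mulmxA; apply: TwistBase.
  by rewrite mulmxA -piW // -mulmxA pu.
- rewrite !mulmxA !(actWX act) ?Dn_conj //.
  have -> : x *m rho t *m rho (w ^ t)^-1%g = x *m rho w^-1%g *m rho t.
    rewrite -!mulmxA -!sp_mxM -conjVg; congr (_ *m rho _).
    by rewrite conjgE mulKVg.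
  by rewrite -[_ *m W _ *m u]mulmxA -[_ *m W _ *m v]mulmxA; apply: TwistX.
- by rewrite !mulmxDr -!scalemxAr; apply: TwistLin.
Qed.

(** By induction: the elements y kill the image of pi, and commuting y past x leaves
    terms covered by stability under W. *)
Lemma twist_relY y u v : twist_rel u v ->
  twist_rel (Y y *m u) (Y (rho t *m y) *m v).
Proof.
have tt : rho t *m rho t = 1%:M by rewrite -sp_mxM t_sqr sp_mx1.
elim=> {u v} [u pu|x u v uv IH|a u v u' v' _ IH _ IH'].
- by rewrite -pu -pi_phi !mulmxA !Ypi !mul0mx; apply: twist_rel0.
- have -> : Y y *m (X x *m u) = X x *m (Y y *m u) + pairing x y *: u +
      - c *: \sum_(s in refl) pairing x ((1%:M - rho s) *m y) *: (W s *m u).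
    rewrite mulmxA (actYX act) mulmxBl mulmxDl mul_scalar_mx mulmxA scaleNr.
    rewrite -scalemxAl mulmx_suml; congr (_ - _ *: _); apply: eq_bigr => s _.
    by rewrite scalemxAl.
  have -> : Y (rho t *m y) *m (X (x *m rho t) *m v) =
      X (x *m rho t) *m (Y (rho t *m y) *m v) + pairing x y *: v +
      - c *: \sum_(s in refl) pairing x ((1%:M - rho s) *m y) *: (W (s ^ t)%g *m v).
    rewrite mulmxA (actYX act) mulmxBl mulmxDl mul_scalar_mx mulmxA scaleNr.
    have -> : pairing (x *m rho t) (rho t *m y) = pairing x y.
      by rewrite /pairing mulmxA -[x *m _ *m _]mulmxA tt mulmx1.
    rewrite -scalemxAl mulmx_suml; congr (_ - _ *: _).
    rewrite (reindex_inj (conjg_inj t)) /=; apply: eq_big => [s|s _].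
      by rewrite refl_conj.
    rewrite -scalemxAl; congr (_ *: _).
    rewrite /pairing; congr (fun_of_matrix _ _ _).
    rewrite -!mulmxA; congr (_ *m _); rewrite !mulmxA; congr (_ *m _).
    rewrite mulmxBr mulmxBl mulmx1 tt -!sp_mxM; congr (_ - rho _).
    by rewrite conjgE mulKVg -mulgA t_sqr mulg1.
  apply: twist_relD; first by apply: twist_relD; [apply: TwistX|apply: twist_relZ].
  apply/twist_relZ/twist_rel_sum => s s_refl; apply: twist_relZ.
  exact: twist_relW (refl_Dn s_refl) uv.
- by rewrite !mulmxDr -!scalemxAr; apply: TwistLin.
Qed.

Lemma twist_rel_total u : exists v, twist_rel u v.
Proof.
have [_ all_of_stable] := irr; move: u.
apply: (all_of_stable (fun u => exists v, twist_rel u v))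
  => [|w v wD [v' vv']|x v [v' vv']|y v [v' vv']|].
- split=> [|a v v' [w vw] [w' vw']]; first by exists 0; apply: twist_rel0.
  by exists (a *: w + w'); apply: TwistLin.
- by exists (W (w ^ t)%g *m v'); apply: twist_relW.
- by exists (X (x *m rho t) *m v'); apply: TwistX.
- by exists (Y (rho t *m y) *m v'); apply: twist_relY.
have [v piv] := neq0_col pi_neq0; have pipi : pi *m (pi *m v) = pi *m v.
  by rewrite mulmxA pi_idem.
by exists (pi *m v) => //; exists (phi *m (pi *m v)); apply: TwistBase.
Qed.

(** The elements related to 0 form a submodule; if it were everything, its lowest part
    would be zero by [twist_rel_proj], that is pi = 0. *)
Lemma twist_rel_fun u v v' : twist_rel u v -> twist_rel u v' -> v = v'.
Proof.
move=> uv uv'; have := TwistLin (-1) uv uv'; rewrite !scaleN1r addNr => rel0.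
apply/eqP; rewrite eq_sym -subr_eq0 addrC; apply/negPn/negP => nz.
case/eqP: pi_neq0; apply: mulmx_col_ext => z; rewrite mul0mx.
suff : twist_rel 0 z by move=> /twist_rel_proj ->; rewrite mulmx0.
have [_ all_of_stable] := irr; move: z.
apply: (all_of_stable (twist_rel 0)) => [|w z wD rz|x z rz|y z rz|].
- split=> [|a z z' rz rz']; first exact: twist_rel0.
  by have := TwistLin a rz rz'; rewrite scaler0 addr0.
- have := @twist_relW (w ^ t)%g _ _ _ rz; rewrite Dn_conj => /(_ wD).
  by rewrite mulmx0 conjtK.
- by have := TwistX (x *m rho t) rz; rewrite mulmx0 twistK.
- by have := twist_relY (rho t *m y) rz; rewrite mulmx0 Ktwist.
- by exists (- v + v').
Qed.

Lemma twist_matrix : exists S : 'M[F]_m,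
  [/\ S != 0, forall w, w \in Dn n -> S *m W w = W (w ^ t)%g *m S,
      forall x, S *m X x = X (x *m rho t) *m S &
      forall y, S *m Y y = Y (rho t *m y) *m S].
Proof.
have [f fP] := choice twist_rel_total.
pose S : 'M[F]_m := \matrix_(i, j) f (delta_mx j 0) i 0.
have SP u : twist_rel u (S *m u).
  have -> : S *m u = \sum_j u j 0 *: f (delta_mx j 0).
    apply/matrixP => i k; rewrite ord1 mxE summxE; apply: eq_bigr => j _.
    by rewrite !mxE mulrC.
  have {1}-> : u = \sum_j u j 0 *: delta_mx j 0.
    apply/matrixP => i k; rewrite ord1 summxE (bigD1 i) //= big1 => [|j ji]; rewrite !mxE.
      by rewrite !eqxx mulr1 addr0.
    by rewrite eq_sym (negbTE ji) mulr0.
  by apply: twist_rel_sum => j _; apply: twist_relZ.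
have comm (Z Z' : 'M[F]_m) : (forall u v, twist_rel u v -> twist_rel (Z *m u) (Z' *m v)) ->
    S *m Z = Z' *m S.
  move=> ZZ'; apply: mulmx_col_ext => u; rewrite -!mulmxA.
  by apply: (twist_rel_fun (SP _)); apply: ZZ'.
exists S; split=> [|w wD|x|y].
- apply: contra_neq phi_neq0 => S0; apply: mulmx_col_ext => u.
  by rewrite mul0mx -(twist_rel_proj (SP u)) S0 mul0mx mulmx0.
- by apply: comm => u v; apply: twist_relW.
- by apply: comm => u v; apply: TwistX.
- by apply: comm => u v; apply: twist_relY.
Qed.

End Relation.

(** The square of S commutes with the action, hence is a scalar, nonzero because the
    kernel of S is a submodule; division by a square root normalizes it to 1. *)
Lemma twist_involution : exists S : 'M[F]_m,
  [/\ S *m S = 1%:M, forall w, w \in Dn n -> S *m W w = W (w ^ t)%g *m S,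
      forall x, S *m X x = X (x *m rho t) *m S &
      forall y, S *m Y y = Y (rho t *m y) *m S].
Proof.
have [pi [phi [[pi0 pi_idem piX Ypi piW] [phi0 pi_phi phi_pi phiW]]]] := lowest_intertwiner.
have [S [S0 SW SX SY]] := twist_matrix pi0 pi_idem piX Ypi piW phi0 pi_phi phi_pi phiW.
have [m0 all_of_stable] := irr.
have S_inj (v : 'cV_m) : S *m v = 0 -> v = 0.
  move=> Sv; apply/eqP/negPn/negP => v0; case/eqP: S0; apply: mulmx_col_ext.
  apply: all_of_stable => [|w u wD|x u|y u|]; first exact: lin_pred_eq.
  - by rewrite !mul0mx mulmxA SW // -mulmxA => ->; rewrite mulmx0.
  - by rewrite !mul0mx mulmxA SX // -mulmxA => ->; rewrite mulmx0.
  - by rewrite !mul0mx mulmxA SY // -mulmxA => ->; rewrite mulmx0.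
  - by exists v; rewrite ?mul0mx.
have [l /char_poly_eigenvector[v v0 Sv]] : exists l, root (char_poly (S *m S)) l.
  by apply/closed_rootP; rewrite size_char_poly eqSS -lt0n.
have comm2 (Z Z' : 'M[F]_m) (u : 'cV_m) : S *m Z = Z' *m S -> S *m Z' = Z *m S ->
    S *m S *m u = l%:M *m u -> S *m S *m (Z *m u) = l%:M *m (Z *m u).
  move=> E E' Eu; have SSZ : S *m S *m Z = Z *m (S *m S).
    by rewrite -mulmxA E mulmxA E' mulmxA.
  by rewrite mulmxA SSZ -mulmxA Eu !mul_scalar_mx scalemxAr.
have SS : S *m S = l%:M.
  apply: mulmx_col_ext; apply: all_of_stable => [|w u wD|x u|y u|].
  - exact: lin_pred_eq.
  - by apply: (comm2 _ (W (w ^ t)%g)); rewrite SW ?Dn_conj ?conjtK.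
  - by apply: (comm2 _ (X (x *m rho t))); rewrite SX ?twistK.
  - by apply: (comm2 _ (Y (rho t *m y))); rewrite SY ?Ktwist.
  - by exists v => //; rewrite Sv mul_scalar_mx.
have l0 : l != 0.
  apply: contraNneq v0 => l0; apply/eqP/S_inj/S_inj.
  by rewrite mulmxA Sv l0 scale0r.
have r0 : sqrtC l != 0 by rewrite sqrtC_eq0.
exists ((sqrtC l)^-1 *: S); split=> [|w wD|x|y].
- rewrite -scalemxAl -scalemxAr scalerA SS -invfM -expr2 sqrtCK scale_scalar_mx.
  by rewrite mulVf.
- by rewrite -scalemxAl -scalemxAr SW.
- by rewrite -scalemxAl -scalemxAr SX.
- by rewrite -scalemxAl -scalemxAr SY.
Qed.

End TwistIso.

(** * Extending an action from type D to type B *)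
Section FreeInduction.
Variables (F : fieldType) (T : choiceType) (P : free_alg F T -> Prop).
Hypothesis P_scal : forall a, P (scal a).
Hypothesis P_add : forall x y, P x -> P y -> P (x + y).
Hypothesis P_mul : forall x y, P x -> P y -> P (x * y).
Hypothesis P_letter : forall l, P (letter F l).

Lemma free_alg_ind p : P p.
Proof.
have P0 : P 0 by rewrite -(assoc_scal0 (free_alg F T)).
have P_mono a (k : word T) : P (<< a *g k >> : {malg F[word T]}).
  elim: k => [|l k IH]; first exact: P_scal.
  have := P_mul (P_letter l) IH; congr P.
  rewrite letter.unlock malgM_def fgmulUU mul1r.
  by [].
rewrite (monalgE p); elim/big_rec: _ => // k q _.
exact: P_add (P_mono _ _).
Qed.

End FreeInduction.

Section CherednikInduction.
Variables (F : fieldType) (gT : finGroupType) (n : nat) (G : {group gT}).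
Variables (rG : mx_representation F G n) (c : gT -> F) (P : cherednik rG c -> Prop).
Hypothesis P_scal : forall a, P (scal a).
Hypothesis P_add : forall x y, P x -> P y -> P (x + y).
Hypothesis P_mul : forall x y, P x -> P y -> P (x * y).
Hypothesis P_W : forall w, w \in G -> P (cherednikW rG c w).
Hypothesis P_X : forall x, P (cherednikX rG c x).
Hypothesis P_Y : forall y, P (cherednikY rG c y).

(** The algebra is a quotient of a quotient of a free algebra, so it is generated by W,
    the elements x and the elements y. *)
Lemma cherednik_ind h : P h.
Proof.
rewrite -(quot_projK h) -(quot_projK (quot_repr h)).
move: (quot_repr (quot_repr h)) => p.
rewrite -[quot_proj _ _]/(quot_hom _ (quot_hom _ p)); move: p; apply: free_alg_ind.
- by move=> a; rewrite !alg_hom_scal.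
- by move=> p q Pp Pq; rewrite !alg_homD; apply: P_add.
- by move=> p q Pp Pq; rewrite !alg_homM; apply: P_mul.
- case=> [[u|x]|y]; [|exact: P_X|exact: P_Y].
  by have := P_W (subgP u); rewrite /cherednikW /smashW /letterW sgvalK.
Qed.

End CherednikInduction.

Lemma cherednik_hom_ext (F : fieldType) (gT : finGroupType) (n : nat) (G : {group gT})
    (rG : mx_representation F G n) (c : gT -> F) (A : assocAlgType F)
    (f g : algHom (cherednik rG c) A) :
  (forall w, w \in G -> f (cherednikW rG c w) = g (cherednikW rG c w)) ->
  (forall x, f (cherednikX rG c x) = g (cherednikX rG c x)) ->
  (forall y, f (cherednikY rG c y) = g (cherednikY rG c y)) ->
  forall h, f h = g h.
Proof.
move=> fgW fgX fgY; elim/cherednik_ind => [a|x y IHx IHy|x y IHx IHy|w wG|x|y].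
- by rewrite !alg_hom_scal.
- by rewrite !alg_homD IHx IHy.
- by rewrite !alg_homM IHx IHy.
- exact: fgW.
- exact: fgX.
- exact: fgY.
Qed.

Section AlgHomComp.
Variables (F : fieldType) (A B C : assocAlgType F) (g : algHom B C) (f : algHom A B).

Let compD : {morph (fun a => g (f a)) : x y / x + y}.
Proof. by move=> x y; rewrite !alg_homD. Qed.
Let compM : {morph (fun a => g (f a)) : x y / x * y}.
Proof. by move=> x y; rewrite !alg_homM. Qed.
Let comp_scal a : g (f (scal a)) = scal a.
Proof. by rewrite !alg_hom_scal. Qed.

Definition alg_hom_comp : algHom A C := AlgHom compD compM comp_scal.
End AlgHomComp.

Section SignedPermAction.
Variables (F : numClosedFieldType) (n m : nat) (c : F).
Variables (W : signed_perm n -> mx_alg F m) (X : 'rV[F]_n -> mx_alg F m)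
  (Y : 'cV[F]_n -> mx_alg F m).
Hypothesis act : cherednik_map (Dn_repr n F) (fun=> c) W X Y.
Variables (t : signed_perm n) (S : mx_alg F m).
Hypothesis t_odd : t \notin Dn n.
Hypothesis t_sqr : (t * t = 1)%g.
Local Notation rho := (@sp_mx n F).
Hypothesis SS : S *m S = 1%:M.
Hypothesis SW : forall w, w \in Dn n -> S *m W w = W (w ^ t)%g *m S.
Hypothesis SX : forall x, S *m X x = X (x *m rho t) *m S.
Hypothesis SY : forall y, S *m Y y = Y (rho t *m y) *m S.

(** An odd w is (w t) t, and t acts by S. *)
Definition extendW (w : signed_perm n) : mx_alg F m :=
  if w \in Dn n then W w else W (w * t)%g *m S.

Lemma Dn_mul_odd w : w \notin Dn n -> (w * t)%g \in Dn n.
Proof.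
by move: t_odd; rewrite !mem_Dn !negbK neg_parityM => -> ->.
Qed.

Let tV : (t^-1 = t)%g.
Proof. by apply: (mulgI t); rewrite mulgV t_sqr. Qed.

(** The coordinate reflections have parameter 0, so the commutator of y and x involves
    only reflections of D_n. *)
Lemma extended_action :
  cherednik_map (Bn_repr n F) (Bn_param c 0) extendW X Y.
Proof.
split.
- by rewrite /extendW group1 (cmapW1 act).
- move=> u v _ _; rewrite /extendW -[_ * _ in RHS]/(_ *m _).
  case: (boolP (u \in Dn n)) => uD; case: (boolP (v \in Dn n)) => vD.
  + by rewrite groupM // (actWM act).
  + by rewrite groupMl // (negbTE vD) -mulgA (actWM act) ?Dn_mul_odd // mulmxA.
  + rewrite groupMr // (negbTE uD) -mulmxA SW // mulmxA.
    rewrite -(actWM act) ?Dn_conj ?Dn_mul_odd //.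
    by rewrite conjgE tV !mulgA -[(u * t * t)%g]mulgA t_sqr mulg1.
  + have -> : (u * v)%g \in Dn n.
      by move: uD vD; rewrite !mem_Dn !negbK neg_parityM => -> ->.
    rewrite -!mulmxA [S *m (W _ *m _)]mulmxA SW ?Dn_mul_odd // -mulmxA SS mulmx1.
    rewrite -(actWM act) ?Dn_conj ?Dn_mul_odd //; congr W.
    by rewrite conjgE tV !mulgA -[(u * t * t)%g]mulgA t_sqr mulg1 -mulgA t_sqr mulg1.
- exact: (cmapX_lin act).
- exact: (cmapY_lin act).
- move=> w x _; rewrite /extendW /= -[_ * X _]/(_ *m _) -[X _ * _]/(_ *m _).
  case: (boolP (w \in Dn n)) => wD; first exact: (cmapWX act).
  rewrite -mulmxA SX !mulmxA (actWX act) ?Dn_mul_odd //; congr (X _ *m _ *m _).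
  rewrite invMg tV sp_mxM mulmxA -[x *m rho t *m rho t]mulmxA -sp_mxM t_sqr.
  by rewrite sp_mx1 mulmx1.
- move=> w y _; rewrite /extendW /= -[_ * Y _]/(_ *m _) -[Y _ * _]/(_ *m _).
  case: (boolP (w \in Dn n)) => wD; first exact: (cmapWY act).
  rewrite -mulmxA SY !mulmxA (actWY act) ?Dn_mul_odd //; congr (Y _ *m _ *m _).
  by rewrite mulmxA -sp_mxM -mulgA t_sqr mulg1.
- exact: (cmapXX act).
- exact: (cmapYY act).
move=> y x; rewrite (cmapYX act); congr (_ - _).
have two_neq0 : (2 : F) != 0 by rewrite pnatr_eq0.
have := sum_reflections_BnDn two_neq0 c (fun s => pairing (refl_root rho s) y)
  (fun s => pairing x (refl_coroot rho s)) extendW.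
move=> ->; apply: eq_bigr => s /refl_Dn sD.
by rewrite /extendW sD.
Qed.

End SignedPermAction.

(** * Representations in coordinates *)

Import VectorInternalTheory.

Lemma hom_cherednik_map (F : fieldType) (gT : finGroupType) (n : nat) (G : {group gT})
    (rG : mxrepresentation.mx_representation F G n) (c : gT -> F) (A : assocAlgType F)
    (f : algHom (cherednik rG c) A) :
  cherednik_map rG c (fun w => f (cherednikW rG c w)) (fun x => f (cherednikX rG c x))
    (fun y => f (cherednikY rG c y)).
Proof.
split.
- by rewrite cherednikW1 alg_hom1.
- by move=> u v uG vG; rewrite cherednikWM // alg_homM.
- by move=> a x x'; rewrite cherednikX_lin alg_homD alg_homM alg_hom_scal.
- by move=> a y y'; rewrite cherednikY_lin alg_homD alg_homM alg_hom_scal.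
- by move=> w x wG; apply/alg_hom_eqMM/cherednikWX.
- by move=> w y wG; apply/alg_hom_eqMM/cherednikWY.
- by move=> x x'; apply/alg_hom_eqMM/cherednikXX.
- by move=> y y'; apply/alg_hom_eqMM/cherednikYY.
move=> y x; have := congr1 f (cherednikYX rG c y x).
rewrite !alg_homB alg_hom_scal alg_hom_sum !alg_homM => ->.
by congr (_ - _); apply: eq_bigr => s _; rewrite alg_homM alg_hom_scal.
Qed.

Section Coordinates.
Variables (F : fieldType) (vT : vectType F).
Local Notation d := (dim vT).

Definition col_of (v : vT) : 'cV[F]_d := (v2r v)^T.
Definition of_col (u : 'cV[F]_d) : vT := r2v u^T.
Definition end_mx (f : 'End(vT)) : 'M[F]_d := (f2mx f)^T.
Definition mx_end (M : 'M[F]_d) : 'End(vT) := Hom M^T.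

Lemma col_ofK : cancel col_of of_col.
Proof. by move=> v; rewrite /of_col trmxK v2rK. Qed.

Lemma of_colK : cancel of_col col_of.
Proof. by move=> u; rewrite /col_of r2vK trmxK. Qed.

Lemma end_mxE f v : end_mx f *m col_of v = col_of (f v).
Proof. by rewrite /end_mx /col_of -trmx_mul unlock /= r2vK. Qed.

Lemma mx_endE M v : col_of (mx_end M v) = M *m col_of v.
Proof. by rewrite -end_mxE /end_mx trmxK. Qed.

Lemma col_of_lin a u v : col_of (a *: u + v) = a *: col_of u + col_of v.
Proof. by rewrite /col_of !linearP. Qed.

Lemma end_mx_ext (A B : 'M[F]_d) : (forall v, A *m col_of v = B *m col_of v) -> A = B.
Proof. by move=> E; apply: mulmx_col_ext => u; rewrite -[u]of_colK. Qed.
End Coordinates.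

Section RepMatrices.
Variables (F : numClosedFieldType) (n : nat) (c : F) (V : fdRep (cherednik_D n c)).
Local Notation sp := (rep_space V).
Local Notation d := (dim sp).
Local Notation D_repr := (Dn_repr n F).

Definition rep_mx (h : cherednik_D n c) : mx_alg F d := end_mx (rep_act V h).

Lemma rep_mxE h v : rep_mx h *m col_of v = col_of (rep_act V h v).
Proof. exact: end_mxE. Qed.

Lemma rep_mxD : {morph rep_mx : a b / a + b}.
Proof.
move=> a b; apply: end_mx_ext => v; rewrite mulmxDl !rep_mxE rep_actD add_lfunE.
by rewrite /col_of !linearD.
Qed.

Lemma rep_mxM : {morph rep_mx : a b / a * b}.
Proof.
move=> a b; apply: end_mx_ext => v; rewrite -[_ * _ in RHS]/(_ *m _) -mulmxA !rep_mxE.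
by rewrite rep_actM comp_lfunE.
Qed.

Lemma rep_mx_scal a : rep_mx (scal a) = scal a.
Proof.
apply: end_mx_ext => v; rewrite rep_mxE rep_act_scal scale_lfunE id_lfunE.
by rewrite -[scal a]/(a%:M) mul_scalar_mx /col_of !linearZ.
Qed.

Definition rep_hom : algHom (cherednik_D n c) (mx_alg F d) :=
  AlgHom rep_mxD rep_mxM rep_mx_scal.

Local Notation W := (fun w => rep_hom (cherednikW D_repr (fun=> c) w)).
Local Notation X := (fun x => rep_hom (cherednikX D_repr (fun=> c) x)).
Local Notation Y := (fun y => rep_hom (cherednikY D_repr (fun=> c) y)).

Lemma rep_act_irreducible : irreducible_rep V -> act_irreducible W X Y.
Proof.
move=> [V0 Virr]; split.
  rewrite lt0n; apply/eqP => d0; case: V0; apply/eqP; rewrite -subv0.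
  apply/subvP => v _; rewrite memv0 -[v]col_ofK; apply/eqP.
  suff -> : col_of v = 0 by rewrite /of_col trmx0 linear0.
  by apply/matrixP => i; have := ltn_ord i; rewrite [X in (_ < X)%N]d0.
move=> P [P0 PD] PW PX PY [u0 u00 Pu0] u.
have Ph h : forall v, P v -> P (rep_hom h *m v).
  elim/cherednik_ind: h => [a|x y IHx IHy|x y IHx IHy|w wD|x|y] v Pv.
  - rewrite alg_hom_scal -[scal a]/(a%:M) mul_scalar_mx -[_ *: _]addr0.
    exact: PD.
  - rewrite alg_homD mulmxDl -[rep_hom x *m v]scale1r.
    by apply: PD; [apply: IHx|apply: IHy].
  - by rewrite alg_homM -[_ * _]/(_ *m _) -mulmxA; apply/IHx/IHy.
  - exact: PW.
  - exact: PX.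
  - exact: PY.
have [||U UP] := @vspace_of_pred _ _ (fun v : sp => P (col_of v)).
- by rewrite /col_of linear0 trmx0.
- by move=> a v v' Pv Pv'; rewrite col_of_lin; apply: PD.
have [a|U0|Uf] := Virr U.
- apply/subvP => _ /memv_imgP[v /UP Pv ->]; apply/UP.
  by rewrite -rep_mxE; apply: Ph.
- case/eqP: u00; have /UP : P (col_of (of_col u0)) by rewrite of_colK.
  rewrite U0 memv0 => /eqP u00; rewrite -[u0]of_colK u00.
  by rewrite /col_of linear0 trmx0.
- by rewrite -[u]of_colK; apply/UP; rewrite Uf memvf.
Qed.

Lemma rep_extension : (0 < n)%N -> irreducible_rep V ->
  exists g : algHom (cherednik_B n c 0) (mx_alg F d),
    [/\ forall w, w \in Dn n -> g (cherednikW (Bn_repr n F) (Bn_param c 0) w) = W w,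
        forall x, g (cherednikX (Bn_repr n F) (Bn_param c 0) x) = X x &
        forall y, g (cherednikY (Bn_repr n F) (Bn_param c 0) y) = Y y].
Proof.
move=> n0 Virr; pose t := sign_flip (Ordinal n0).
have t_odd : t \notin Dn n by rewrite mem_Dn negbK sign_flip_parity.
have t_sqr : (t * t = 1)%g := sign_flip_sqr _.
have act := hom_cherednik_map rep_hom.
have [S [SS SW SX SY]] := twist_involution act (rep_act_irreducible Virr) t_odd t_sqr n0.
have actB := extended_action act t_odd t_sqr SS SW SX SY.
exists (cherednik_lift actB); split=> [w wD|x|y].
- by rewrite cherednik_liftW ?inE // /extendW wD.
- exact: cherednik_liftX.
- exact: cherednik_liftY.
Qed.

End RepMatrices.

Section MatrixRep.
Variables (F : fieldType) (A : assocAlgType F) (vT : vectType F).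
Variable g : algHom A (mx_alg F (dim vT)).

Definition mx_act (a : A) : 'End(vT) := mx_end (g a).

Lemma mx_actE a v : col_of (mx_act a v) = g a *m col_of v.
Proof. exact: mx_endE. Qed.

Let eq_end (f f' : 'End(vT)) : (forall v, col_of (f v) = col_of (f' v)) -> f = f'.
Proof. by move=> E; apply/lfunP => v; apply: (can_inj (@col_ofK _ _)). Qed.

Lemma mx_actD : {morph mx_act : a b / a + b}.
Proof.
move=> a b; apply: eq_end => v; rewrite mx_actE alg_homD mulmxDl -!mx_actE add_lfunE.
by rewrite /col_of !linearD.
Qed.

Lemma mx_actM a b : mx_act (a * b) = (mx_act a \o mx_act b)%VF.
Proof.
by apply: eq_end => v; rewrite comp_lfunE !mx_actE alg_homM mulmxA.
Qed.

Lemma mx_act_scal (k : F) : mx_act (scal k) = k *: \1%VF.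
Proof.
apply: eq_end => v; rewrite mx_actE alg_hom_scal -[scal k]/(k%:M) mul_scalar_mx.
by rewrite scale_lfunE id_lfunE /col_of !linearZ.
Qed.

Definition mx_rep : fdRep A := FdRep mx_actD mx_actM mx_act_scal.
End MatrixRep.

Theorem mainTheorem2 (R : realType) (n : nat) (hn : (4 <= n)%N) (c : R[i])
    (V : fdRep (cherednik_D n c)) (hV : irreducible_rep V) :
  exists L : fdRep (cherednik_B n c 0%R),
    irreducible_rep L /\ rep_isomorphic V (rep_restrict (cherednik_DB n c) L).
Proof.
have [g [gW gX gY]] := rep_extension (leq_trans (isT : (0 < 4)%N) hn) hV.
have gDB h : g (cherednik_DB n c h) = rep_hom V h.
  move: h; apply: (@cherednik_hom_ext _ _ _ _ _ _ _
    (alg_hom_comp g (cherednik_DB n c)) (rep_hom V)) => [w wD|x|y].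
  - exact: etrans (congr1 g (cherednik_DBW c wD)) (gW _ wD).
  - exact: etrans (congr1 g (cherednik_DBX c x)) (gX _).
  - exact: etrans (congr1 g (cherednik_DBY c y)) (gY _).
have actE h : rep_act (mx_rep g) (cherednik_DB n c h) = rep_act V h.
  by rewrite /= /mx_act gDB; apply: val_inj; rewrite /= trmxK.
exists (mx_rep g); split.
  split=> [|U Ustable]; first exact: hV.1.
  by apply: hV.2 => a; rewrite -actE; apply: Ustable.
exists \1%VF; split; first by exists id => v; rewrite id_lfunE.
by move=> a v; rewrite !id_lfunE -actE.
Qed.
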